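(* Let $\Sigma$ be a finite alphabet with at least two letters. (1) The Büchi topology on $T_\Sigma^\omega$ is strong Choquet, but it is neither regular (hence not zero-dimensional) nor metrizable. (2) The Muller topology on $T_\Sigma^\omega$ is zero-dimensional, regular and metrizable, but it is not strong Choquet. In particular, neither the Büchi topology nor the Muller topology on $T_\Sigma^\omega$ is Polish.
   Context: $T_\Sigma^\omega$ is the set of maps $\{l,r\}^*\to\Sigma$ (infinite binary $\Sigma$-labelled trees). A tree automaton is $(\Sigma,Q,q_0,\Delta)$ with finite $Q$, $q_0\in Q$, $\Delta\subseteq Q\times\Sigma\times Q\times Q$; a run on $t$ is $\rho:\{l,r\}^*\to Q$ with $\rho(\text{root})=q_0$ and $(\rho(u),t(u),\rho(ul),\rho(ur))\in\Delta$ for all nodes $u$. A Büchi tree automaton adds $Q_f\subseteq Q$, and a run is accepting if on every infinite branch some state of $Q_f$ occurs infinitely often. A Muller tree automaton adds $\mathcal{F}\subseteq 2^Q$, and a run is accepting if for every infinite branch the set of states occurring infinitely often on it belongs to $\mathcal{F}$. A tree is accepted if some run on it is accepting. The Büchi topology is generated by the tree languages accepted by Büchi tree automata; the Muller topology is generated by the tree languages accepted by Muller tree automata (regular tree languages). Strong Choquet: nonempty and Player 2 has a winning strategy in the strong Choquet game. *)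

(* Defs.v *)
From HB Require Import structures.
From mathcomp Require Import all_boot.
From Stdlib Require Import Reals.
Set Implicit Arguments.
Unset Strict Implicit.
Unset Printing Implicit Defensive.

(* A node of {l,r}^* is a list of directions, stored in REVERSE order
   (most recent direction first): false = l, true = r.
   The children of u are (false :: u) (= ul) and (true :: u) (= ur). *)
Definition node := seq bool.
Definition tree (S : finType) := node -> S.

Fixpoint node_at (pi : nat -> bool) (n : nat) : node :=
  match n with
  | 0 => [::]
  | n'.+1 => pi n' :: node_at pi n'
  end.

Definition is_run (S Q : finType) (q0 : Q) (Delta : Q -> S -> Q -> Q -> bool)
  (t : tree S) (rho : node -> Q) : Prop :=
  rho [::] = q0 /\
  forall u : node, Delta (rho u) (t u) (rho (false :: u)) (rho (true :: u)).

Definition inf_often (Q : finType) (rho : node -> Q) (pi : nat -> bool) (q : Q) : Prop :=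
  forall N : nat, exists n : nat, N <= n /\ rho (node_at pi n) = q.

Definition buchi_accepting (Q : finType) (Qf : {set Q}) (rho : node -> Q) : Prop :=
  forall pi : nat -> bool, exists q, q \in Qf /\ inf_often rho pi q.

Definition muller_accepting (Q : finType) (F : {set {set Q}}) (rho : node -> Q) : Prop :=
  forall pi : nat -> bool,
    exists2 P : {set Q}, P \in F & forall q : Q, q \in P <-> inf_often rho pi q.

Definition buchi_recognizable (S : finType) (L : tree S -> Prop) : Prop :=
  exists (Q : finType) (q0 : Q) (Delta : Q -> S -> Q -> Q -> bool) (Qf : {set Q}),
    forall t : tree S,
      L t <-> exists rho, is_run q0 Delta t rho /\ buchi_accepting Qf rho.

Definition muller_recognizable (S : finType) (L : tree S -> Prop) : Prop :=
  exists (Q : finType) (q0 : Q) (Delta : Q -> S -> Q -> Q -> bool) (F : {set {set Q}}),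
    forall t : tree S,
      L t <-> exists rho, is_run q0 Delta t rho /\ muller_accepting F rho.

Definition generated_open (X : Type) (B : (X -> Prop) -> Prop) (U : X -> Prop) : Prop :=
  forall x, U x ->
    exists (k : nat) (A : nat -> X -> Prop),
      (forall i, i < k -> B (A i)) /\
      (forall i, i < k -> A i x) /\
      (forall y, (forall i, i < k -> A i y) -> U y).

Definition buchi_open (S : finType) : (tree S -> Prop) -> Prop :=
  generated_open (@buchi_recognizable S).

Definition muller_open (S : finType) : (tree S -> Prop) -> Prop :=
  generated_open (@muller_recognizable S).

Arguments buchi_open S : clear implicits.
Arguments muller_open S : clear implicits.

Section Topology.
Variable X : Type.
Variable open : (X -> Prop) -> Prop.

Definition closed (C : X -> Prop) : Prop := open (fun x => ~ C x).

Definition clopen (C : X -> Prop) : Prop := open C /\ closed C.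

Definition regular : Prop :=
  forall (x : X) (C : X -> Prop), closed C -> ~ C x ->
    exists U V : X -> Prop, open U /\ open V /\ U x /\
      (forall y, C y -> V y) /\ (forall y, ~ (U y /\ V y)).

Definition zero_dimensional : Prop :=
  forall (U : X -> Prop) (x : X), open U -> U x ->
    exists V, clopen V /\ V x /\ forall y, V y -> U y.

Definition is_metric (d : X -> X -> R) : Prop :=
  (forall x y, (0 <= d x y)%R) /\
  (forall x y, d x y = 0%R <-> x = y) /\
  (forall x y, d x y = d y x) /\
  (forall x y z, (d x z <= d x y + d y z)%R).

Definition compatible_metric (d : X -> X -> R) : Prop :=
  is_metric d /\
  forall U : X -> Prop,
    open U <-> (forall x, U x -> exists eps : R, (0 < eps)%R /\
                  forall y, (d x y < eps)%R -> U y).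

Definition metrizable : Prop := exists d, compatible_metric d.

Definition complete_metric (d : X -> X -> R) : Prop :=
  forall s : nat -> X,
    (forall eps : R, (0 < eps)%R -> exists N, forall m n, N <= m -> N <= n ->
       (d (s m) (s n) < eps)%R) ->
    exists y, forall eps : R, (0 < eps)%R -> exists N, forall n, N <= n ->
       (d (s n) y < eps)%R.

Definition separable : Prop :=
  exists s : nat -> X, forall U, open U -> (exists x, U x) -> exists n, U (s n).

Definition polish : Prop :=
  separable /\ exists d, compatible_metric d /\ complete_metric d.

(* Strong Choquet game.  Round n: Player 1 plays (x_n, U_n) with U_n open,
   x_n \in U_n, and U_n \subseteq V_{n-1} (n > 0); Player 2 answers an open
   V_n with x_n \in V_n \subseteq U_n.  Player 2 wins iff \bigcap_n V_n is
   nonempty.  A strategy for Player 2 maps the (nonempty) history of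
   Player 1's moves to Player 2's answer. *)
Definition strategy2 := seq (X * (X -> Prop)) -> (X -> Prop).

Definition history (x : nat -> X) (U : nat -> X -> Prop) (n : nat) :=
  [seq (x k, U k) | k <- iota 0 n.+1].

Definition legal_upto (sigma : strategy2) (x : nat -> X) (U : nat -> X -> Prop)
  (n : nat) : Prop :=
  forall k, k <= n ->
    open (U k) /\ U k (x k) /\
    (0 < k -> forall y, U k y -> sigma (history x U k.-1) y).

Definition winning2 (sigma : strategy2) : Prop :=
  (forall x U n, legal_upto sigma x U n ->
     let V := sigma (history x U n) in
     open V /\ V (x n) /\ forall y, V y -> U n y) /\
  (forall x U, (forall n, legal_upto sigma x U n) ->
     exists y, forall n, sigma (history x U n) y).

Definition strong_choquet : Prop :=
  (exists x : X, True) /\ exists sigma : strategy2, winning2 sigma.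

End Topology.

(* Main.v *)
(* Everything rests on two facts.
   (i) Rabin: regular tree languages are closed under complement. If no run on t is
   accepting then, the acceptance game being a parity game after adding the latest
   appearance record as memory, Pathfinder has a positional winning strategy; an
   automaton guesses this strategy node by node and checks it along every branch
   with a deterministic Muller automaton (McNaughton).
   (ii) L = "some branch carries infinitely many a's" is Buchi recognizable, but its
   complement is not the projection of a closed subset of trees x sequences: the
   tree of attempts to verify t can be drawn with labels depending on shallower
   nodes of t only, so it has a fixed point t, for which t is in L iff it is not.

   By (i) the Muller topology has a countable base of clopen sets, hence is
   zero-dimensional and (ultra)metrizable. In a strong Choquet topology with a
   countable base finer than the product topology every open set is such a
   projection: guess a play, taken from a countable tree of moves, whose open sets
   shrink to t. As the complement of L is Muller open, (ii) excludes this.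
   Were the Buchi topology regular, each x in L would have a basic neighborhood
   separated from the complement of L by an open set; there are countably many of
   these and they intersect in the complement of L, making it such a projection,
   against (ii). Finally Player 2 wins the Buchi Choquet game by freezing ever
   longer prefixes of the tree and of accepting runs of all the automata entered so
   far, each time deep enough to meet a final state on every branch. *)
Require Import Defs.
From HB Require Import structures.
From mathcomp Require Import all_boot.
From mathcomp.classical Require Import boolp.
From Stdlib Require Import Reals Lra.
Set Implicit Arguments.
Unset Strict Implicit.
Unset Printing Implicit Defensive.

(** * Infinite recurrence and limit sets of sequences *)

Definition infinitely (P : nat -> Prop) : Prop :=
  forall N, exists n, N <= n /\ P n.

Lemma not_infinitely (P : nat -> Prop) :
  ~ infinitely P -> exists N, forall n, N <= n -> ~ P n.
Proof.
move=> /existsNP[N HN]; exists N => n Nn Pn; apply: HN; by exists n.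
Qed.

Lemma infinitely_sub (P P' : nat -> Prop) :
  (forall n, P n -> P' n) -> infinitely P -> infinitely P'.
Proof. by move=> PP' iP N; have [n [Nn /PP']] := iP N; exists n. Qed.

Lemma infinitely_shift (P : nat -> Prop) (k : nat) :
  infinitely (fun n => P (n + k)) <-> infinitely P.
Proof.
split=> iP N.
  have [n [Nn Pn]] := iP N; exists (n + k); split=> //.
  exact: leq_trans Nn (leq_addr _ _).
have [n [Nn Pn]] := iP (N + k); exists (n - k).
have kn : k <= n := leq_trans (leq_addl _ _) Nn.
by rewrite subnK // -(leq_add2r k) subnK.
Qed.

Lemma eventually_seq (T : eqType) (s : seq T) (P : T -> nat -> Prop) :
  (forall x, x \in s -> exists N, forall n, N <= n -> P x n) ->
  exists N, forall n, N <= n -> forall x, x \in s -> P x n.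
Proof.
elim: s => [|x s IH] H; first by exists 0.
have [|N1 H1] := IH; first by move=> y ys; apply: H; rewrite inE ys orbT.
have [N2 H2] := H x (mem_head _ _).
exists (maxn N1 N2) => n; rewrite geq_max => /andP[n1 n2] y.
by rewrite inE => /orP[/eqP->|/H1]; auto.
Qed.

Lemma eventually_fin (T : finType) (P : T -> nat -> Prop) :
  (forall x, exists N, forall n, N <= n -> P x n) ->
  exists N, forall n, N <= n -> forall x, P x n.
Proof.
move=> H; have [|N HN] := @eventually_seq T (enum T) P; first by move=> x _.
by exists N => n Nn x; apply: HN => //; rewrite mem_enum.
Qed.

Lemma infinitely_pigeonhole (T : finType) (P : T -> nat -> Prop) :
  infinitely (fun n => exists x, P x n) -> exists x, infinitely (P x).
Proof.
move=> iP; apply: contrapT => /forallNP H.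
have [|N HN] := @eventually_fin T (fun x n => ~ P x n).
  by move=> x; apply: not_infinitely.
have [n [Nn [x Pxn]]] := iP N.
exact: HN Nn _ Pxn.
Qed.

Definition infset (T : finType) (w : nat -> T) : {set T} :=
  [set q | `[< infinitely (fun n => w n = q) >]].

Lemma infsetP (T : finType) (w : nat -> T) q :
  q \in infset w <-> infinitely (fun n => w n = q).
Proof. by rewrite inE; split=> [/asboolP|/asboolP]. Qed.

Lemma eventually_infset (T : finType) (w : nat -> T) :
  exists N, forall n, N <= n -> w n \in infset w.
Proof.
have [|N HN] := @eventually_fin T (fun q n => w n = q -> q \in infset w).
  move=> q; case: (boolP (q \in infset w)) => [//|/negP qN]; first by exists 0.
  have /not_infinitely[N HN] : ~ infinitely (fun n => w n = q) by move/infsetP.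
  by exists N => n /HN.
by exists N => n /HN; apply.
Qed.

Lemma infset_map (T T' : finType) (f : T -> T') (w : nat -> T) :
  infset (f \o w) = f @: infset w.
Proof.
apply/setP => q; apply/idP/imsetP => [/infsetP iq|[x /infsetP ix ->]].
  have [|x /= ix] := @infinitely_pigeonhole T (fun x n => w n = x /\ f x = q).
    by apply: infinitely_sub iq => n /= <-; exists (w n).
  exists x; last by have [n [_ []]] := ix 0.
  by apply/infsetP; apply: infinitely_sub ix => n [].
by apply/infsetP; apply: infinitely_sub ix => n /= ->.
Qed.

Lemma muller_acceptingE (Q : finType) (F : {set {set Q}}) (rho : node -> Q) :
  muller_accepting F rho <-> forall pi, infset (rho \o node_at pi) \in F.
Proof.
split=> H pi.
  have [P PF HP] := H pi; suff -> : infset (rho \o node_at pi) = P by [].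
  by apply/setP => q; apply/idP/idP => [/infsetP/HP|/HP/infsetP].
by exists (infset (rho \o node_at pi)) => // q; apply: infsetP.
Qed.

Lemma nonincreasing_stabilizes (g : nat -> nat) :
  (forall n, g n.+1 <= g n) -> exists N, forall n, N <= n -> g n = g N.
Proof.
move=> gd; suff [N HN] : exists N, forall n, g N <= g n.
  have mono n k : g (n + k) <= g n.
    by elim: k => [|k IH]; rewrite ?addn0 // addnS (leq_trans (gd _)).
  exists N => n Nn; apply/eqP; rewrite eqn_leq HN andbT.
  by rewrite -(subnKC Nn) mono.
suff H m : forall N, g N <= m -> exists N, forall n, g N <= g n by exact: (H (g 0) 0).
elim: m => [|m IH] N gN.
  by exists N => n; move: gN; rewrite leqn0 => /eqP ->.
have [?|/existsNP[n /negP]] := pselect (forall n, g N <= g n); first by exists N.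
rewrite -ltnNge => lt; apply: (IH n); rewrite -ltnS; exact: leq_trans lt gN.
Qed.

(** * Positional determinacy of parity games *)

Lemma neq_negb (a b : bool) : a != b -> a = ~~ b.
Proof. by case: a; case: b. Qed.

Section ParityGames.
Variables (V : countType) (owner : V -> bool) (succ : V -> seq V) (prio : V -> nat).

(** Max-parity condition: odd priorities favour player [true]. On a play with unbounded priorities
    nobody wins. *)
Definition parity_won (b : bool) (p : nat -> V) : Prop :=
  exists m, [/\ odd m = b, infinitely (fun n => prio (p n) = m) &
                exists N, forall n, N <= n -> prio (p n) <= m].

Lemma parity_won_shift b p k : parity_won b (fun n => p (n + k)) -> parity_won b p.
Proof.
move=> [m [mb im [N HN]]]; exists m; split=> //.
  exact/(infinitely_shift (fun n => prio (p n) = m) k).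
exists (N + k) => n Nkn; have kn : k <= n := leq_trans (leq_addl _ _) Nkn.
by have := HN (n - k); rewrite subnK //; apply; rewrite -(leq_add2r k) subnK.
Qed.

Lemma parity_won_contra p : parity_won true p -> parity_won false p -> False.
Proof.
move=> [m [mb im [N HN]]] [m' [mb' im' [N' HN']]].
have [n [Nn e]] := im N'; have [n' [Nn' e']] := im' N.
have := HN _ Nn'; have := HN' _ Nn; rewrite e e' => h1 h2.
have E : m = m' by apply/eqP; rewrite eqn_leq h1 h2.
by move: mb mb'; rewrite E => ->.
Qed.

Definition follows (b : bool) (s : V -> V) (p : nat -> V) : Prop :=
  forall n, p n.+1 \in succ (p n) /\ (owner (p n) = b -> p n.+1 = s (p n)).

(* A region inside the subarena Z that player b never has to leave and on which
   the positional strategy s wins. *)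
Definition paddock (b : bool) (Z W : V -> Prop) (s : V -> V) : Prop :=
  [/\ forall v, W v -> Z v,
      forall v, W v -> owner v = b -> s v \in succ v /\ W (s v),
      forall v, W v -> owner v = ~~ b -> forall v', v' \in succ v -> Z v' -> W v' &
      forall p, (forall n, W (p n)) -> follows b s p -> parity_won b p].

Lemma paddock0 b Z s : paddock b Z (fun _ => False) s.
Proof. by split=> // p /(_ 0). Qed.

Lemma paddock_step b Z W s v v' : paddock b Z W s -> W v ->
  v' \in succ v -> Z v' -> (owner v = b -> v' = s v) -> W v'.
Proof.
move=> [WZ Ws Wo _] Wv v'v Zv' E; have [ob|ob] := eqVneq (owner v) b.
  by rewrite E //; case: (Ws _ Wv ob).
apply: Wo v'v Zv' => //; exact: neq_negb.
Qed.

(** Each position uses the strategy of the first paddock containing it. Along a play that index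
    never increases, so the play eventually follows a single strategy, and winning does not depend
    on a finite prefix. *)
Lemma paddock_bigcup b Z (W : nat -> V -> Prop) (s : nat -> V -> V) :
  (forall i, paddock b Z (W i) (s i)) ->
  exists s', paddock b Z (fun v => exists i, W i v) s'.
Proof.
move=> pad.
have /choice[idx idxP] : forall v, exists i, (exists i, W i v) ->
    W i v /\ forall j, W j v -> i <= j.
  move=> v; have [ex|nex] := pselect (exists i, W i v); last by exists 0.
  have ex' : exists i, `[< W i v >] by case: ex => i /asboolP Wi; exists i.
  case: (ex_minnP ex') => m /asboolP Wm mmin.
  by exists m => _; split=> // j Wj; apply: mmin; apply/asboolP.
exists (fun v => s (idx v) v); split.
- by move=> v [i Wi]; have [WZ _ _ _] := pad i; exact: WZ Wi.
- move=> v /idxP[Wi _] ob; have [_ Ws _ _] := pad (idx v).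
  by have [h1 h2] := Ws _ Wi ob; split=> //; exists (idx v).
- move=> v /idxP[Wi _] ob v' v'v Zv'; have [_ _ Wo _] := pad (idx v).
  by exists (idx v); apply: Wo Wi ob _ v'v Zv'.
move=> p Wp fp.
have Zp n : Z (p n) by have [i Wi] := Wp n; have [WZ _ _ _] := pad i; exact: WZ Wi.
have step n : W (idx (p n)) (p n.+1).
  have [Wn _] := idxP _ (Wp n); have [h1 h2] := fp n.
  exact: paddock_step (pad _) Wn h1 (Zp _) h2.
have [|N HN] := @nonincreasing_stabilizes (fun n => idx (p n)).
  by move=> n; have [_] := idxP _ (Wp n.+1); apply; exact: step.
apply: (@parity_won_shift _ _ N); have [_ _ _ win] := pad (idx (p N)).
apply: win => n.
  by rewrite -(HN (n + N)) ?leq_addl //; have [] := idxP _ (Wp (n + N)).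
rewrite addSn; have [h1 h2] := fp (n + N); split=> // /h2 ->.
by rewrite (HN (n + N)) ?leq_addl.
Qed.

(** Positions are countable, so one paddock for each position that lies in any suffices, and
    [paddock_bigcup] merges them. *)
Lemma paddock_max b Z : exists W s, paddock b Z W s /\
  forall W' s', paddock b Z W' s' -> forall v, W' v -> W v.
Proof.
have /choice[Ws WsP] : forall i, exists Ws : (V -> Prop) * (V -> V),
    paddock b Z Ws.1 Ws.2 /\ forall v, unpickle i = Some v ->
    (exists W' s', paddock b Z W' s' /\ W' v) -> Ws.1 v.
  move=> i; case: (unpickle i) => [v|]; last first.
    by exists (fun _ => False, fun v => v); split=> //; exact: paddock0.
  have [[W' [s' [pd Wv]]]|nex] := pselect (exists W' s', paddock b Z W' s' /\ W' v).
    by exists (W', s'); split=> // _ [<-].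
  exists (fun _ => False, fun v => v); split; first exact: paddock0.
  by move=> _ [<-].
have [|s pd] := @paddock_bigcup b Z (fun i => (Ws i).1) (fun i => (Ws i).2).
  by move=> i; case: (WsP i).
exists (fun v => exists i, (Ws i).1 v), s; split=> // W' s' pd' v W'v.
exists (pickle v); have [_] := WsP (pickle v); apply; first exact: pickleK.
by exists W', s'.
Qed.

(** If [v] is new, a play can be there only at its start: the first move leads into [W], which it
    never leaves. *)
Lemma paddock_add b Z W s v : paddock b Z W s -> Z v ->
  (owner v = b -> exists v', v' \in succ v /\ W v') ->
  (owner v = ~~ b -> forall v', v' \in succ v -> Z v' -> W v') ->
  exists s', paddock b Z (fun w => W w \/ w = v) s'.
Proof.
move=> pd Zv Hb Hnb; have [WZ Ws Wo Wwin] := pd.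
have [Wv|nWv] := pselect (W v).
  exists s; split.
  - by move=> w [/WZ|->].
  - move=> w Ww ow; have {}Ww : W w by case: Ww => [//|->].
    by have [h1 h2] := Ws _ Ww ow; split=> //; left.
  - move=> w Ww ow v' h1 h2; have {}Ww : W w by case: Ww => [//|->].
    by left; apply: Wo h1 h2.
  - move=> p Wp fp; apply: Wwin => // n; by case: (Wp n) => [//|->].
have [v0 v0P] : exists v0, owner v = b -> v0 \in succ v /\ W v0.
  have [ob|ob] := eqVneq (owner v) b; last by exists v => /eqP; rewrite (negbTE ob).
  by have [v' ?] := Hb ob; exists v'.
exists (fun w => if w == v then v0 else s w); split.
- by move=> w [/WZ|->].
- move=> w [Ww|->] ow; last first.
    by rewrite eqxx; have [? ?] := v0P ow; split=> //; left.
  case: eqP => [E|_]; first by case: nWv; rewrite -E.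
  by have [h1 h2] := Ws _ Ww ow; split=> //; left.
- move=> w [Ww|->] ow v' h1 h2; last by left; apply: Hnb.
  by left; apply: Wo h1 h2.
move=> p Wp fp; have Zp n : Z (p n) by case: (Wp n) => [/WZ|->].
have stp n : W (p n.+1).
  have [h1 h2] := fp n; case: (Wp n) => [Wn|E].
    apply: (paddock_step pd Wn h1 (Zp _)) => /h2 ->.
    by case: eqP => // E; case: nWv; rewrite -E.
  have [ob|ob] := eqVneq (owner v) b.
    by rewrite h2 ?E // eqxx; case: (v0P ob).
  by apply: Hnb (neq_negb ob) _ _ (Zp _); rewrite -E.
apply: (@parity_won_shift _ _ 1); apply: Wwin => n; first by rewrite addn1.
rewrite !addn1; have [h1 h2] := fp n.+1; split=> // /h2 ->.
by case: eqP => // E; case: nWv; rewrite -E.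
Qed.

(** Finite stages exhaust the attractor because every position has finitely many successors. *)
Fixpoint attr (b : bool) (Z N : V -> Prop) (k : nat) (v : V) : Prop :=
  if k is k'.+1 then
    attr b Z N k' v \/
    [/\ Z v, owner v = b -> exists v', [/\ v' \in succ v, Z v' & attr b Z N k' v'] &
     owner v = ~~ b -> forall v', v' \in succ v -> Z v' -> attr b Z N k' v']
  else N v.

Lemma attr_mono b Z N k k' v : k <= k' -> attr b Z N k v -> attr b Z N k' v.
Proof.
by move/subnKC <-; elim: (k' - k) => [|j IH]; rewrite ?addn0 // addnS => /IH; left.
Qed.

(* Induction on the number of priorities, after Zielonka. If the top priority n is
   good for b, remove the largest paddock of the opponent, then the attractor of b to
   priority n: the opponent wins nowhere in the rest, for that would enlarge its
   paddock. *)
Lemma parity_determined n (Z : V -> Prop) :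
  (forall v, Z v -> exists v', v' \in succ v /\ Z v') ->
  (forall v, Z v -> prio v < n) ->
  exists (W : bool -> V -> Prop) (s : bool -> V -> V),
    (forall b, paddock b Z (W b) (s b)) /\ forall v, Z v -> exists b, W b v.
Proof.
elim: n Z => [|n IH] Z Ztot Zprio.
  exists (fun _ _ => False), (fun _ v => v); split; first by move=> b; exact: paddock0.
  by move=> v /Zprio.
set b := odd n.
have [Wc [sc [pdc maxc]]] := paddock_max (~~ b) Z.
(* By maximality, [Wc] is closed under one-step attraction for the opponent [~~ b]. *)
have addc v : Z v -> (owner v = ~~ b -> exists v', v' \in succ v /\ Wc v') ->
    (owner v = b -> forall v', v' \in succ v -> Z v' -> Wc v') -> Wc v.
  move=> Zv H1 H2; have [|s' pd'] := paddock_add pdc Zv H1.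
    by rewrite negbK.
  by apply: maxc pd' _ _; right.
pose Z1 v := Z v /\ ~ Wc v.
have Z1c v v' : Z1 v -> owner v = ~~ b -> v' \in succ v -> Z v' -> Z1 v'.
  move=> [Zv nW] ob v'v Zv'; split=> // W'; apply: nW; apply: addc => //.
    by move=> _; exists v'.
  by rewrite ob; case: (b).
have Z1b v : Z1 v -> owner v = b -> exists v', v' \in succ v /\ Z1 v'.
  move=> [Zv nW] ob; apply: contrapT => /forallNP H; apply: nW; apply: addc => //.
    by rewrite ob; case: (b).
  by move=> _ v' v'v Zv'; apply: contrapT => nW'; apply: (H v').
have Z1tot v : Z1 v -> exists v', v' \in succ v /\ Z1 v'.
  move=> Zv; have [ob|ob] := eqVneq (owner v) b; first exact: Z1b.
  have [v' [v'v Zv']] := Ztot _ Zv.1; exists v'; split=> //; apply: Z1c v'v Zv' => //.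
  exact: neq_negb.
pose N v := Z1 v /\ prio v = n.
pose A v := exists k, attr b Z1 N k v.
have AZ1 v : A v -> Z1 v.
  case=> k; elim: k => [[]|k IHk] //= [/IHk|[]] //.
pose Z2 v := Z1 v /\ ~ A v.
have Z2b v v' : Z2 v -> owner v = b -> v' \in succ v -> Z1 v' -> Z2 v'.
  move=> [Zv nA] ob v'v Zv'; split=> // -[k Ak]; apply: nA; exists k.+1; right.
  split=> // [_|]; first by exists v'.
  by rewrite ob; case: (b).
have Z2c v : Z2 v -> owner v = ~~ b -> exists v', v' \in succ v /\ Z2 v'.
  move=> [Zv nA] ob; apply: contrapT => /forallNP H; apply: nA.
  have [|k Hk] := @eventually_seq V (succ v) (fun v' k => Z1 v' -> attr b Z1 N k v').
    move=> v' v'v; have [[k Ak]|nA'] := pselect (A v').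
      by exists k => k' kk' _; apply: attr_mono Ak.
    by exists 0 => k _ Zv'; case: (H v').
  exists k.+1; right; split=> // [|_ v' v'v Zv']; first by rewrite ob; case: (b).
  exact: Hk.
have Z2tot v : Z2 v -> exists v', v' \in succ v /\ Z2 v'.
  move=> Zv; have [ob|ob] := eqVneq (owner v) b; last first.
    by apply: Z2c => //; exact: neq_negb.
  have [v' [v'v Zv']] := Z1b _ Zv.1 ob; exists v'; split=> //; exact: Z2b v'v Zv'.
have [|W [s [pd cov]]] := IH Z2 Z2tot.
  move=> v [Zv nA]; have := Zprio _ Zv.1; rewrite ltnS leq_eqVlt => /orP[/eqP E|//].
  by case: nA; exists 0.
(* A region won by the opponent in [Z2] could be joined to [Wc]: player [b] can leave it only into
   [Wc], where the play is trapped. *)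
have Wc0 v : ~ W (~~ b) v.
  move=> Wv; have [WZ2 Ws Wo Wwin] := pd (~~ b); have [WZ _ _ Wcwin] := pdc.
  have [_] := (WZ2 _ Wv).1; apply.
  apply: (maxc (fun w => Wc w \/ W (~~ b) w)
    (fun w => if pselect (Wc w) then sc w else s (~~ b) w)); last by right.
  have stepW w w' : W (~~ b) w -> w' \in succ w -> Z w' ->
      (owner w = ~~ b -> w' = s (~~ b) w) -> Wc w' \/ W (~~ b) w'.
    move=> Ww w'w Zw' E; have [?|nWc] := pselect (Wc w'); [by left|right].
    have [ob|ob] := eqVneq (owner w) (~~ b).
      by rewrite E //; case: (Ws _ Ww ob).
    have {}ob : owner w = b by rewrite (neq_negb ob) negbK.
    apply: (Wo w) => //; first by rewrite ob negbK.
    by apply: Z2b (WZ2 _ Ww) ob w'w _; split.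
  split.
  - by move=> w [/WZ|/WZ2[[]]].
  - move=> w Ww ow; case: pselect => [Wcw|nWcw].
      by have [_ h _ _] := pdc; have [? ?] := h _ Wcw ow; split=> //; left.
    case: Ww => // Ww; have [? ?] := Ws _ Ww ow; split=> //; by right.
  - move=> w [Ww|Ww] ow w' w'w Zw'.
      by left; have [_ _ h _] := pdc; apply: h w'w Zw'.
    by apply: stepW Ww w'w Zw' _; rewrite ow; case: (b).
  move=> p Wp fp.
  have Zp k : Z (p k) by case: (Wp k) => [/WZ|/WZ2[[]]].
  have [[k Wck]|nWc] := pselect (exists k, Wc (p k)).
    have Wcp j : Wc (p (j + k)).
      elim: j => // j Wj; have [h1 h2] := fp (j + k); rewrite addSn.
      apply: (paddock_step pdc Wj h1 (Zp _)) => /h2 ->; by case: pselect.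
    apply: (@parity_won_shift _ _ k); apply: Wcwin => // j.
    have [h1 h2] := fp (j + k); rewrite addSn; split=> // /h2 ->.
    by case: pselect => // nW; case: nW.
  have {}nWc k : ~ Wc (p k) by move=> ?; apply: nWc; exists k.
  apply: Wwin => k; first by case: (Wp k) => // /nWc.
  by have [h1 h2] := fp k; split=> // /h2 ->; case: pselect => // H; case: (nWc _ H).
have Wb v : Z2 v -> W b v.
  move=> /cov[b' Wv]; have [<-//|nb] := eqVneq b' b; case: (Wc0 v).
  by rewrite -(neq_negb nb).
have [_ Ws Wo Wwin] := pd b.
(* [s1] lowers the stage on the attractor, follows the recursive strategy on [Z2], and on [N] takes
   any move that stays in [Z1]. *)
have /choice[s1 s1P] : forall v, exists v', Z1 v -> owner v = b ->
    [/\ v' \in succ v, Z1 v', Z2 v -> v' = s b v &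
        forall k, attr b Z1 N k.+1 v -> ~ attr b Z1 N k v -> attr b Z1 N k v'].
  move=> v; have [[Zv ob]|nZ] := pselect (Z1 v /\ owner v = b); last first.
    by exists v => h1 h2; case: nZ.
  have [[[|k] Ak]|nA] := pselect (A v).
  - have [v' [h1 h2]] := Z1b _ Zv ob; exists v' => _ _; split=> //.
      by case=> _; case; exists 0.
    by move=> k _; case; apply: attr_mono Ak.
  - have ex : exists k, `[< attr b Z1 N k v >] by exists k.+1; apply/asboolP.
    case: (ex_minnP ex) => -[|m] /asboolP Am mmin.
      have [v' [h1 h2]] := Z1b _ Zv ob; exists v' => _ _; split=> //.
        by case=> _; case; exists 0.
      by move=> k' _; case; apply: attr_mono Am.
    case: (Am) => [/asboolP/mmin|[_ /(_ ob)[v' [h1 h2 h3]] _]]; first by rewrite ltnn.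
    exists v' => _ _; split=> //; first by case=> _; case; exists m.+1.
    move=> k' /asboolP/mmin lmk nAk; apply: attr_mono h3; exact: lmk.
  have Z2v : Z2 v by split.
  have [h1 h2] := Ws _ (Wb _ Z2v) ob.
  exists (s b v) => _ _; split=> //; last by move=> k Ak; case: nA; exists k.+1.
  by apply: (proj1 (_ : Z2 _)); have [WZ2 _ _ _] := pd b; apply: WZ2.
have [WcZ _ _ _] := pdc.
have pd1 : paddock b Z Z1 s1.
  split; first by move=> v [].
  - by move=> v Zv ob; have [? ? _ _] := s1P v Zv ob.
  - by move=> v Zv ob v'; apply: Z1c.
  move=> p Zp fp.
  have attrN k n0 : attr b Z1 N k (p n0) -> exists j, n0 <= j /\ N (p j).
    elim: k n0 => [|k IHk] n0; first by exists n0.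
    move=> Ak; have [/IHk//|nAk] := pselect (attr b Z1 N k (p n0)).
    suff /IHk[j [lj Nj]] : attr b Z1 N k (p n0.+1) by exists j; split=> //; apply: ltnW.
    have [h1 h2] := fp n0.
    have [ob|ob] := eqVneq (owner (p n0)) b.
      by have [_ _ _] := s1P _ (Zp n0) ob; rewrite h2 //; apply.
    case: Ak => [//|[_ _]]; apply=> //.
    exact: neq_negb.
  (* Either [n] recurs, being the largest priority and of parity [b], or the play ends up in [Z2],
     since every visit to [A] is followed by one to [N]. *)
  have [iN|/not_infinitely[M HM]] := pselect (infinitely (fun k => N (p k))).
    exists n; split=> //; first by apply: infinitely_sub iN => k [].
    by exists 0 => k _; have := Zprio _ (Zp k).1; rewrite ltnS.
  have Z2p k : M <= k -> Z2 (p k).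
    move=> Mk; split=> // -[j Aj]; have [i [ki Ni]] := attrN _ _ Aj.
    exact: HM (leq_trans Mk ki) Ni.
  apply: (@parity_won_shift _ _ M); apply: Wwin => k.
    by apply: Wb; apply: Z2p; rewrite leq_addl.
  have [h1 h2] := fp (k + M); rewrite addSn; split=> // ob; rewrite h2 //.
  by have [_ _ h _] := s1P _ (Zp _) ob; apply: h; apply: Z2p; rewrite leq_addl.
exists (fun b' => if b' == b then Z1 else Wc), (fun b' => if b' == b then s1 else sc).
split.
  move=> b'; case: eqP => [->//|/eqP nb].
  by rewrite (neq_negb nb).
move=> v Zv; have [Wv|nWv] := pselect (Wc v); [exists (~~ b)|exists b].
  by case: (b).
by rewrite eqxx.
Qed.

End ParityGames.

(** * Determinization of automata on infinite words *)

Section Profiles.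
Variables (A X : finType) (step : X -> A -> X -> bool).

(* (x, y, P) belongs to the profile of a word when some run over it leads from x
   to y and P is the set of the states it visits, y excluded. *)
Definition profile := {set X * X * {set X}}.

Definition pmul (m1 m2 : profile) : profile :=
  [set c | [exists y, exists P1, exists P2,
    [&& (c.1.1, y, P1) \in m1, (y, c.1.2, P2) \in m2 & c.2 == P1 :|: P2]]].

Definition pone : profile := [set c | (c.1.1 == c.1.2) && (c.2 == set0)].

Definition pletter (a : A) : profile :=
  [set c | step c.1.1 a c.1.2 && (c.2 == [set c.1.1])].

Lemma in_pmul m1 m2 x z P : (x, z, P) \in pmul m1 m2 <->
  exists y P1 P2, [/\ (x, y, P1) \in m1, (y, z, P2) \in m2 & P = P1 :|: P2].
Proof.
rewrite inE /=; split.
  by case/existsP=> y /existsP[P1 /existsP[P2 /and3P[? ? /eqP ?]]]; exists y, P1, P2.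
case=> y [P1 [P2 [h1 h2 h3]]]; apply/existsP; exists y; apply/existsP; exists P1.
by apply/existsP; exists P2; rewrite h1 h2 h3 eqxx.
Qed.

Lemma in_pone x z P : (x, z, P) \in pone <-> x = z /\ P = set0.
Proof. by rewrite inE /=; split=> [/andP[/eqP ? /eqP ?]|[-> ->]]; rewrite ?eqxx. Qed.

Lemma profile_eqP (m1 m2 : profile) :
  (forall x z P, (x, z, P) \in m1 <-> (x, z, P) \in m2) -> m1 = m2.
Proof. by move=> H; apply/setP => -[[x z] P]; apply/idP/idP => /H. Qed.

Lemma pmulA : associative pmul.
Proof.
move=> m1 m2 m3; apply: profile_eqP => x z P; split=> /in_pmul.
  move=> [y [P1 [P2 [h1 /in_pmul[y' [P3 [P4 [h3 h4 ->]]]] ->]]]].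
  apply/in_pmul; exists y', (P1 :|: P3), P4; split=> //; last by rewrite setUA.
  by apply/in_pmul; exists y, P1, P3.
move=> [y [P1 [P2 [/in_pmul[y' [P3 [P4 [h3 h4 ->]]]] h2 ->]]]].
apply/in_pmul; exists y', P3, (P4 :|: P2); split=> //; last by rewrite setUA.
by apply/in_pmul; exists y, P4, P2.
Qed.

Lemma pmul1m : left_id pone pmul.
Proof.
move=> m; apply: profile_eqP => x z P; split.
  by move=> /in_pmul[y [P1 [P2 [/in_pone[-> ->] h2 ->]]]]; rewrite set0U.
move=> h; apply/in_pmul; exists x, set0, P; split=> //; last by rewrite set0U.
exact/in_pone.
Qed.

Lemma pmulm1 : right_id pone pmul.
Proof.
move=> m; apply: profile_eqP => x z P; split.
  by move=> /in_pmul[y [P1 [P2 [h2 /in_pone[<- ->] ->]]]]; rewrite setU0.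
move=> h; apply/in_pmul; exists z, P, set0; split=> //; last by rewrite setU0.
exact/in_pone.
Qed.

#[warning="-redundant-canonical-projection"]
HB.instance Definition _ := Monoid.isLaw.Build profile pone pmul pmulA pmul1m pmulm1.

Definition pr (alpha : nat -> A) (i j : nat) : profile :=
  \big[pmul/pone]_(i <= k < j) pletter (alpha k).

Lemma pr_id alpha i : pr alpha i i = pone.
Proof. by rewrite /pr big_geq. Qed.

Lemma pr_split alpha i j k : i <= j <= k ->
  pr alpha i k = pmul (pr alpha i j) (pr alpha j k).
Proof. by case/andP=> ij jk; rewrite /pr (big_cat_nat _ (n := j)). Qed.

Lemma pr_recr alpha i j : i <= j ->
  pr alpha i j.+1 = pmul (pr alpha i j) (pletter (alpha j)).
Proof. by move=> ij; rewrite /pr big_nat_recr. Qed.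

Lemma prP alpha i j x z P : i <= j -> (x, z, P) \in pr alpha i j <->
  exists r : nat -> X, [/\ r i = x, r j = z,
    forall k, i <= k < j -> step (r k) (alpha k) (r k.+1) &
    forall q, q \in P <-> exists2 k, i <= k < j & r k = q].
Proof.
move=> ij; rewrite -(subnKC ij); move: (j - i) => d {ij j}.
elim: d z P => [|d IH] z P.
  rewrite addn0 pr_id; split=> [/in_pone[<- ->]|[r [<- <- _ HP]]].
    exists (fun _ => x); split=> // [k /andP[h1 h2]|q].
      by move: (leq_trans h2 h1); rewrite ltnn.
    by rewrite inE; split=> // -[k /andP[h1 h2]]; move: (leq_trans h2 h1); rewrite ltnn.
  apply/in_pone; split=> //; apply/setP => q; rewrite inE; apply/negbTE/negP.
  by move=> /HP[k /andP[h1 h2]]; move: (leq_trans h2 h1); rewrite ltnn.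
rewrite addnS pr_recr ?leq_addr //; split.
  move=> /in_pmul[y [P1 [P2 [/IH[r [r0 rd rstep HP1]]]]]].
  rewrite inE /= => /andP[st /eqP->] ->.
  exists (fun k => if k <= i + d then r k else z).
  rewrite leq_addr ltnn; split=> // [k /andP[ik]|q].
    rewrite ltnS => kd; rewrite kd; move: kd.
    rewrite leq_eqVlt => /orP[/eqP->|lt]; first by rewrite ltnn rd.
    by rewrite lt; apply: rstep; rewrite ik.
  rewrite !inE; split.
    case/orP=> [/HP1[k /andP[ik kd] <-]|/eqP->].
      by exists k; rewrite ?(ltnW kd) // ik ltnS ltnW.
    by exists (i + d); rewrite ?leqnn ?leq_addr ?ltnSn.
  case=> k /andP[ik]; rewrite ltnS => kd; rewrite kd.
  move: kd; rewrite leq_eqVlt => /orP[/eqP->|lt]; first by rewrite rd => ->; rewrite eqxx orbT.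
  by move=> <-; apply/orP; left; apply/HP1; exists k; rewrite ?ik.
case=> r [r0 rd rstep HP].
pose P1 : {set X} := [set q | `[< exists2 k, i <= k < i + d & r k = q >]].
apply/in_pmul; exists (r (i + d)), P1, [set r (i + d)]; split.
- apply/IH; exists r; split=> // [k /andP[ik kd]|q]; first by apply: rstep; rewrite ik ltnS ltnW.
  by rewrite inE; split=> /asboolP.
- by rewrite inE /= eqxx andbT -rd; apply: rstep; rewrite leq_addr ltnSn.
apply/setP => q; rewrite !inE; apply/idP/orP.
  move=> /HP[k /andP[ik]]; rewrite ltnS leq_eqVlt => /orP[/eqP->|lt] <-; first by right.
  by left; apply/asboolP; exists k; rewrite ?ik.
case=> [/asboolP[k /andP[ik kd] <-]|/eqP->]; apply/HP.
  by exists k; rewrite // ik ltnS ltnW.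
by exists (i + d); rewrite ?leq_addr ?ltnSn.
Qed.

Variables (x0 : X) (F : {set X} -> Prop).

(** A run over a nonempty factor visits its starting state, so no visited set is empty. Hence [pone]
    identifies the token born at the current time. *)
Lemma pr_neq1 alpha i j : i < j -> pr alpha i j <> pone.
Proof.
move=> ij E; have : (x0, x0, set0) \in pr alpha i j by rewrite E; apply/in_pone.
move=> /(prP _ _ _ _ (ltnW ij))[r [_ _ _ H]].
by have := (H (r i)).2 (ex_intro2 _ _ i _ erefl); rewrite inE leqnn ij => /(_ isT).
Qed.

Definition word_accepted (alpha : nat -> A) : Prop :=
  exists r : nat -> X, [/\ r 0 = x0, forall n, step (r n) (alpha n) (r n.+1) &
                           F (infset r)].

Definition profiles_accepted (m : nat -> profile) : Prop :=
  exists (y : nat -> X) (P : nat -> {set X}),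
    [/\ y 0 = x0, forall k, (y k, y k.+1, P k) \in m k &
        F [set q | `[< infinitely (fun k => q \in P k) >]]].

Section Cuts.
Variable c : nat -> nat.
Hypotheses (c0 : c 0 = 0) (cS : forall k, c k < c k.+1).

Lemma cut_mono k k' : k <= k' -> c k <= c k'.
Proof.
by move/subnKC <-; elim: (k' - k) => [|d IH]; rewrite ?addn0 // addnS (leq_trans IH) // ltnW.
Qed.

Lemma leq_cut k : k <= c k.
Proof. by elim: k => // k IH; apply: leq_ltn_trans IH _. Qed.

Fixpoint blk n :=
  if n is n'.+1 then if c (blk n').+1 <= n then (blk n').+1 else blk n' else 0.

Lemma blkP n : c (blk n) <= n < c (blk n).+1.
Proof.
elim: n => [|n /andP[h1 h2]] /=; first by rewrite c0 (leq_ltn_trans _ (cS 0)).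
case: (leqP (c (blk n).+1) n.+1) => h; last by rewrite h (leqW h1).
by rewrite h /= (leq_ltn_trans h2).
Qed.

Lemma blk_eq n k : c k <= n < c k.+1 -> blk n = k.
Proof.
move=> /andP[h1 h2]; have /andP[h3 h4] := blkP n.
apply/eqP; rewrite eqn_leq; apply/andP; split; rewrite leqNgt; apply/negP.
  by move=> /cut_mono h; move: (leq_trans h2 (leq_trans h h3)); rewrite ltnn.
by move=> /cut_mono h; move: (leq_trans h4 (leq_trans h h1)); rewrite ltnn.
Qed.

(** Runs on the blocks agree at the cuts and glue to one run, in which a state recurs iff infinitely
    many blocks visit it. Hence only the profiles of the blocks matter. *)
Lemma word_accepted_cut alpha :
  word_accepted alpha <-> profiles_accepted (fun k => pr alpha (c k) (c k.+1)).
Proof.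
have infE (r : nat -> X) (P : nat -> {set X}) :
    (forall k q, q \in P k <-> exists2 n, c k <= n < c k.+1 & r n = q) ->
    [set q | `[< infinitely (fun k => q \in P k) >]] = infset r.
  move=> HP; apply/setP => q; rewrite !inE; apply: asbool_equiv_eq; split=> iq N.
    have [k [Nk /HP[n /andP[h1 h2] h3]]] := iq N; exists n; split=> //.
    exact: leq_trans (leq_trans Nk (leq_cut k)) h1.
  have [n [Nn rn]] := iq (c N); exists (blk n); split.
    have /andP[_ h2] := blkP n; rewrite leqNgt; apply/negP => /cut_mono h.
    by move: (leq_ltn_trans Nn (leq_trans h2 h)); rewrite ltnn.
  by apply/HP; exists n => //; exact: blkP.
split=> [[r [r0 rs rF]]|[y [P [y0 yP PF]]]].
  pose P k : {set X} := [set q | `[< exists2 n, c k <= n < c k.+1 & r n = q >]].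
  have HP k q : q \in P k <-> exists2 n, c k <= n < c k.+1 & r n = q.
    by rewrite inE; split=> /asboolP.
  exists (fun k => r (c k)), P; split; rewrite ?c0 //; last by rewrite (infE r).
  by move=> k; apply/prP; [exact: ltnW|exists r].
have /choice[r rP] : forall k, exists r : nat -> X, [/\ r (c k) = y k,
    r (c k.+1) = y k.+1, forall n, c k <= n < c k.+1 -> step (r n) (alpha n) (r n.+1) &
    forall q, q \in P k <-> exists2 n, c k <= n < c k.+1 & r n = q].
  by move=> k; apply/prP => //; exact: ltnW.
pose R n := r (blk n) n.
exists R; split.
- by rewrite /R /= -{2}c0; have [-> _ _ _] := rP 0.
- move=> n; have nb := blkP n; have [_ r2 r3 _] := rP (blk n).
  have := r3 n nb; rewrite /R /=; case: ltngtP => // [h|E]; rewrite -?ltnS.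
    case/andP: nb => _; rewrite ltnNge -ltnS => /negP; case; exact: h.
  by rewrite -E r2; have [<- _ _ _] := rP (blk n).+1.
rewrite -(infE R P) // => k q; have [_ _ _ HP] := rP k; rewrite HP.
split=> -[n nk <-]; exists n => //; by rewrite /R (blk_eq nk).
Qed.

End Cuts.
End Profiles.

(** * Merging tokens as the memory of a deterministic automaton *)

Section Tokens.
Variables (A X : finType) (step : X -> A -> X -> bool) (x0 : X).
Let profile := profile X.
Let pone : profile := pone X.
Let letter : A -> profile := pletter step.

(* The live tokens are named by their current profile: the table of a word maps the
   profiles (x, y) of live tokens i and j to (i < j, profile of the word between i and j). *)
Definition table := {ffun profile * profile -> option (bool * profile)}.

Definition live (T : table) x : bool := T (x, x) != None.
Definition older (T : table) x y := if T (x, y) is Some (b, _) then b else false.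
Definition between (T : table) x y := if T (x, y) is Some (_, e) then e else pone.
(** Birth times are unbounded and profiles change, so a token is tracked by its place in the age
    order, which is constant once no older token dies. *)
Definition age_rank (T : table) x := #|[set y | older T y x]|.

Definition parent (T : table) a x' : option profile :=
  [pick x | [&& live T x, pmul x (letter a) == x' &
     [forall y, (live T y && (pmul y (letter a) == x')) ==> ~~ older T y x]]].

(** In the table of a word the newborn token is recognized by [pone]. The factor between the births
    of an older token and the newborn is the whole current profile [c.1] of the former, whence
    [Some (true, c.1)]. *)
Definition next_table (T : table) a : table := [ffun c : profile * profile =>
  match parent T a c.1, parent T a c.2 with
  | Some x, Some y => T (x, y)
  | Some x, None => if c.2 == pone then Some (true, c.1) else None
  | None, Some y => if c.1 == pone then Some (false, pone) else None
  | None, None => if (c.1 == pone) && (c.2 == pone) then Some (false, pone) else None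
  end].

Definition table0 : table := [ffun c : profile * profile =>
  if (c.1 == pone) && (c.2 == pone) then Some (false, pone) else None].

Definition token_dies (T : table) a (k : nat) : Prop := exists x y,
  [/\ live T x, live T y, older T y x, age_rank T x <= k &
      pmul y (letter a) = pmul x (letter a)].

(** In the table of a word [z] is token 0, which never dies. So [s] is the profile of the prefix
    before the birth of the absorbing token, and [e] that of the factor between the two births. *)
Definition token_absorbs (T : table) a (k : nat) (s e : profile) : Prop :=
  exists z x y, [/\ live T z, forall z', ~~ older T z' z, live T x, live T y &
   [/\ age_rank T x = k, older T x y, pmul x (letter a) = pmul y (letter a),
       between T z x = s & between T x y = e]].

Section Word.
Variable alpha : nat -> A.
Notation pr := (pr step alpha).

(* Token i is born at time i and survives as long as no older token has the same
   profile; two tokens with the same profile never separate again. *)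
Definition alive i n := (i <= n) && all (fun i' => pr i' n != pr i n) (iota 0 i).

Lemma aliveP i n : reflect (i <= n /\ forall i', i' < i -> pr i' n <> pr i n) (alive i n).
Proof.
apply: (iffP andP) => -[le H]; split=> //.
  by move=> i' lt; apply/eqP; move/allP: H; apply; rewrite mem_iota.
by apply/allP => i'; rewrite mem_iota /= add0n => lt; apply/eqP/H.
Qed.

Lemma merged_later i j n n' : i <= n -> j <= n -> n <= n' -> pr i n = pr j n ->
  pr i n' = pr j n'.
Proof.
move=> li lj nn E.
by rewrite (@pr_split _ _ _ _ i n) ?li // (@pr_split _ _ _ _ j n) ?lj // E.
Qed.

Lemma alive_earlier i n n' : i <= n -> n <= n' -> alive i n' -> alive i n.
Proof.
move=> li nn /aliveP[_ H]; apply/aliveP; split=> // i' lt E; apply: (H i' lt).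
apply: merged_later nn E => //; exact: leq_trans (ltnW lt) li.
Qed.

Lemma alive_born i : alive i i.
Proof.
apply/aliveP; split=> // i' lt; rewrite pr_id; exact: pr_neq1.
Qed.

Lemma alive_inj i j n : alive i n -> alive j n -> pr i n = pr j n -> i = j.
Proof.
move=> /aliveP[_ Hi] /aliveP[_ Hj] E.
by case: (ltngtP i j) => // [/Hj|/Hi]; rewrite E.
Qed.

Lemma representative i n : i <= n ->
  exists i0, [/\ i0 <= i, alive i0 n & pr i0 n = pr i n].
Proof.
move=> li; have ex : exists k, pr k n == pr i n by exists i.
case: (ex_minnP ex) => m /eqP E mmin; have mi := mmin i (eqxx _).
exists m; split=> //; apply/aliveP; split; first exact: leq_trans mi li.
move=> i' lt E'; have := mmin i'; rewrite E' E eqxx => /(_ isT).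
by rewrite leqNgt lt.
Qed.

Definition token n x : option nat :=
  let i := find (fun i => pr i n == x) (iota 0 n.+1) in if i <= n then Some i else None.

Lemma tokenP n x i : token n x = Some i <-> alive i n /\ pr i n = x.
Proof.
rewrite /token; set f := find _ _; split.
  case: ifP => // fn [<-].
  have hs : has (fun i => pr i n == x) (iota 0 n.+1) by rewrite has_find size_iota.
  have := nth_find 0 hs; rewrite -/f nth_iota // add0n => /eqP E.
  split=> //; apply/aliveP; split=> // i' lt; rewrite E => /eqP E'.
  have := @before_find _ 0 (fun i => pr i n == x) (iota 0 n.+1) i' lt.
  by rewrite nth_iota ?add0n ?E' // ltnS; apply: leq_trans (ltnW lt) fn.
move=> [ai E]; have /aliveP[li H] := ai.
have hs : has (fun i => pr i n == x) (iota 0 n.+1).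
  by apply/hasP; exists i; rewrite ?mem_iota //; apply/eqP.
have := hs; rewrite has_find size_iota -/f ltnS => fn; rewrite fn; congr Some.
have := nth_find 0 hs; rewrite -/f nth_iota // add0n => /eqP Ef.
apply/eqP; rewrite eqn_leq; apply/andP; split; rewrite leqNgt; apply/negP => lt.
  have := @before_find _ 0 (fun i => pr i n == x) (iota 0 n.+1) i lt.
  by rewrite nth_iota ?add0n ?E ?eqxx.
by apply: (H _ lt); rewrite Ef E.
Qed.

Definition tab n : table := [ffun c : profile * profile =>
  if token n c.1 is Some i then
    if token n c.2 is Some j then Some (i < j, pr i j) else None
  else None].

Lemma liveP n x : live (tab n) x <-> exists2 i, alive i n & pr i n = x.
Proof.
rewrite /live ffunE /=; split.
  by case E : (token n x) => [i|//] _; exists i; have /tokenP[] := E.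
by move=> [i ai E]; have /tokenP-> : alive i n /\ pr i n = x by [].
Qed.

Lemma tab_alive n i j : alive i n -> alive j n ->
  tab n (pr i n, pr j n) = Some (i < j, pr i j).
Proof.
move=> ai aj; rewrite ffunE /=.
have /tokenP-> : alive i n /\ pr i n = pr i n by [].
by have /tokenP-> : alive j n /\ pr j n = pr j n by [].
Qed.

Lemma older_alive n i j : alive i n -> alive j n ->
  older (tab n) (pr i n) (pr j n) = (i < j).
Proof. by move=> ai aj; rewrite /older tab_alive. Qed.

Lemma olderP n x y : older (tab n) x y <->
  exists i j, [/\ alive i n, alive j n, pr i n = x, pr j n = y & i < j].
Proof.
split=> [|[i [j [ai aj <- <- lt]]]]; last by rewrite older_alive.
rewrite /older ffunE /=.
case Ei : (token n x) => [i|//]; case Ej : (token n y) => [j|//] lt.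
by exists i, j; have /tokenP[? ?] := Ei; have /tokenP[? ?] := Ej.
Qed.

Lemma between_alive n i j : alive i n -> alive j n ->
  between (tab n) (pr i n) (pr j n) = pr i j.
Proof. by move=> ai aj; rewrite /between tab_alive. Qed.

Lemma token_next n x' : token n.+1 x' =
  match parent (tab n) (alpha n) x' with
  | Some x => token n x
  | None => if x' == pone then Some n.+1 else None
  end.
Proof.
rewrite /parent; case: pickP => [x /and3P[/liveP[i ai Ei] /eqP Ex /forallP xmin]|noP].
  have -> : token n x = Some i by apply/tokenP.
  have /aliveP[li _] := ai.
  apply/tokenP; split; last by rewrite pr_recr // Ei.
  apply/aliveP; split; first exact: leqW.
  move=> i' lt; rewrite !pr_recr ?(leq_trans (ltnW lt)) // Ei Ex => E'.
  have [i0 [l0 a0 E0]] := representative (leq_trans (ltnW lt) li).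
  have := xmin (pr i' n); rewrite -E0 -Ei older_alive // (leq_ltn_trans l0 lt) implybF.
  case/negP; apply/andP; split; first by apply/liveP; exists i0.
  by rewrite E0 E'.
have noTok i : i <= n -> token n.+1 x' <> Some i.
  move=> li /tokenP[ai Ei]; have ai' : alive i n by apply: alive_earlier ai.
  have /negP := noP (pr i n); apply; apply/and3P; split.
  - by apply/liveP; exists i.
  - by rewrite -Ei pr_recr.
  apply/forallP => y; apply/implyP => /andP[/liveP[j aj <-] /eqP Ej].
  rewrite older_alive // -leqNgt leqNgt; apply/negP => lt.
  have /aliveP[_ /(_ _ lt)] := ai; apply; rewrite Ei pr_recr //; by case/aliveP: aj.
have tok i : token n.+1 x' = Some i -> i = n.+1 /\ x' = pone.
  move=> E; have /tokenP[/aliveP[li _] Ei] := E.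
  move: li; rewrite leq_eqVlt => /orP[/eqP El|]; last by rewrite ltnS => /noTok.
  by rewrite -Ei El pr_id.
case: eqP => [->|nx].
  by apply/tokenP; rewrite alive_born pr_id.
by case E : token => [i|//]; have [_] := tok _ E.
Qed.

Lemma parentP n x' x : parent (tab n) (alpha n) x' = Some x ->
  exists i, [/\ token n x = Some i, i <= n & pr i n.+1 = x'].
Proof.
rewrite /parent; case: pickP => // y /and3P[/liveP[i ai Ei] /eqP Ex _] [<-].
have /aliveP[li _] := ai; exists i; split=> //; first exact/tokenP.
by rewrite pr_recr // Ei.
Qed.

(** Birth times enter the definition of the table but not its update, so the table can serve as the
    state of a finite deterministic automaton. *)
Lemma tab_next n : tab n.+1 = next_table (tab n) (alpha n).
Proof.
apply/ffunP => -[x y]; rewrite [LHS]ffunE [RHS]ffunE /= !token_next.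
case Ex : parent => [x'|]; case Ey : parent => [y'|].
- by rewrite ffunE.
- have [i [-> li <-]] := parentP Ex; case: ifP => // _; by rewrite ltnS li.
- have [j [-> lj _]] := parentP Ey; case: ifP => // _.
  by rewrite ltnNge (leqW lj) /=; rewrite /pr big_geq // ltnW.
by case: ifP => //= _; case: ifP => // _; rewrite ltnn pr_id.
Qed.

Lemma tab0 : tab 0 = table0.
Proof.
have tok x : token 0 x = if x == pone then Some 0 else None.
  by rewrite /token /= pr_id eq_sym; case: (x == pone).
apply/ffunP => -[x y]; rewrite !ffunE /= !tok.
by do 2![case: eqP => //= _]; rewrite pr_id.
Qed.

Lemma age_rankE i n : alive i n ->
  age_rank (tab n) (pr i n) = count (alive^~ n) (iota 0 i).
Proof.
move=> ai; rewrite -size_filter.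
have <- : size [seq pr j n | j <- [seq j <- iota 0 i | alive j n]] =
    size [seq j <- iota 0 i | alive j n] by rewrite size_map.
have /card_uniqP <- : uniq [seq pr j n | j <- [seq j <- iota 0 i | alive j n]].
  rewrite map_inj_in_uniq ?filter_uniq ?iota_uniq // => j j'.
  by rewrite !mem_filter => /andP[aj _] /andP[aj' _]; apply: alive_inj.
apply: eq_card => y; rewrite inE; apply/idP/mapP.
  move=> /olderP[j [i' [aj ai' Ey Ei lt]]]; exists j => //.
  by rewrite mem_filter aj mem_iota /= add0n -(alive_inj ai' ai Ei).
move=> [j]; rewrite mem_filter mem_iota /= add0n => /andP[aj lt] ->.
by rewrite older_alive.
Qed.

Lemma age_rank_mono i j n : alive i n -> alive j n -> i < j ->
  age_rank (tab n) (pr i n) < age_rank (tab n) (pr j n).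
Proof.
move=> ai aj lt; rewrite !age_rankE // -(subnKC lt) addSnnS iotaD count_cat.
by rewrite -{1}[count _ _]addn0 ltn_add2l /= add0n ai.
Qed.

Lemma age_rank_inj i j n : alive i n -> alive j n ->
  age_rank (tab n) (pr i n) = age_rank (tab n) (pr j n) -> i = j.
Proof.
move=> ai aj E; case: (ltngtP i j) => // lt.
  by have := age_rank_mono ai aj lt; rewrite E ltnn.
by have := age_rank_mono aj ai lt; rewrite E ltnn.
Qed.

Lemma token_survives i n k : alive i n -> age_rank (tab n) (pr i n) <= k ->
  ~ token_dies (tab n) (alpha n) k -> alive i n.+1.
Proof.
move=> ai rk nd; have /aliveP[li _] := ai.
apply/aliveP; split; first exact: leqW.
move=> i' lt E; apply: nd; have li' := leq_trans (ltnW lt) li.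
have [i0 [l0 a0 E0]] := representative li'.
exists (pr i n), (pr i0 n); split=> //; first by apply/liveP; exists i.
- by apply/liveP; exists i0.
- by rewrite older_alive // (leq_ltn_trans l0).
by rewrite E0 -!pr_recr.
Qed.

Lemma token_diesP n k : token_dies (tab n) (alpha n) k ->
  exists i, [/\ alive i n, age_rank (tab n) (pr i n) <= k & ~~ alive i n.+1].
Proof.
move=> [x [y [_ _ /olderP[j [i [aj ai Ej Ei lt]]] rk E]]]; exists i.
rewrite ai Ei rk; split=> //; apply/negP => /aliveP[_ /(_ _ lt)]; apply.
have /aliveP[li _] := ai; have /aliveP[lj _] := aj.
by rewrite !pr_recr // Ei Ej.
Qed.

Lemma rank_stable i n k : alive i n -> age_rank (tab n) (pr i n) <= k ->
  ~ token_dies (tab n) (alpha n) k ->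
  age_rank (tab n.+1) (pr i n.+1) = age_rank (tab n) (pr i n).
Proof.
move=> ai rk nd; rewrite !age_rankE //; last exact: token_survives rk nd.
have /aliveP[li _] := ai.
apply: eq_in_count => j; rewrite mem_iota /= add0n => lt; apply/idP/idP.
  by apply: alive_earlier; [exact: leq_trans (ltnW lt) li|].
move=> aj; apply: token_survives nd => //.
exact: leq_trans (ltnW (age_rank_mono aj ai lt)) rk.
Qed.

Lemma token_absorbsP n k s e : token_absorbs (tab n) (alpha n) k s e <->
  exists i j, [/\ alive i n, alive j n, i < j, pr i n.+1 = pr j n.+1 &
    [/\ age_rank (tab n) (pr i n) = k, pr 0 i = s & pr i j = e]].
Proof.
have a0 : alive 0 n by apply/aliveP.
split.
  move=> [z [x [y [/liveP[i0 ai0 <-] zmin _ _]]]].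
  move=> [<- /olderP[i [j [ai aj <- <- lt]]] E <- <-].
  have z0 : i0 = 0.
    by have := zmin (pr 0 n); rewrite older_alive // lt0n negbK => /eqP.
  subst i0; exists i, j; rewrite !between_alive //; split=> //.
  have /aliveP[li _] := ai; have /aliveP[lj _] := aj; by rewrite !pr_recr.
move=> [i [j [ai aj lt E [rk <- <-]]]].
have /aliveP[li _] := ai; have /aliveP[lj _] := aj.
exists (pr 0 n), (pr i n), (pr j n); rewrite !between_alive // older_alive //.
split=> //; last by rewrite -!pr_recr.
- by apply/liveP; exists 0.
- by move=> z'; apply/negP => /olderP[i' [j' [ai' aj' _ /(alive_inj aj' a0)-> ]]].
- by apply/liveP; exists i.
- by apply/liveP; exists j.
Qed.

(** There are finitely many tokens below [B], and each dies at most once. *)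
Lemma eventually_stable B : exists N, forall n, N <= n ->
  forall j, j < B -> alive j n -> alive j n.+1.
Proof.
have [|N HN] := @eventually_seq nat (iota 0 B) (fun j n => alive j n -> alive j n.+1).
  move=> j _; have [H|/existsNP[m /not_implyP[jm nm]]] :=
    pselect (forall n, j <= n -> alive j n).
    by exists j => n jn _; apply: H; exact: leqW.
  exists m => n mn an; case: nm; exact: alive_earlier jm mn an.
by exists N => n Nn j jB; apply: HN => //; rewrite mem_iota.
Qed.

(** Otherwise no sufficiently late token ever merges with a given one, so more than [#|profile|]
    tokens can be picked that never merge pairwise; after all their births two of them must share a
    profile. *)
Lemma infinite_class : exists i, forall B, exists j, [/\ B <= j, i <= j &
  exists2 m, j <= m & pr i m = pr j m].
Proof.
apply: contrapT => /forallNP H.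
have /choice[b bP] : forall i, exists b, forall j, b <= j -> i <= j ->
    forall m, j <= m -> pr i m <> pr j m.
  move=> i; have /existsNP[B HB] := H i; exists B => j Bj ij m jm E; apply: HB.
  by exists j; split=> //; exists m.
suff [s [us szs sep]] : exists s : seq nat, [/\ uniq s, size s = #|profile|.+1 &
    forall i j m, i \in s -> j \in s -> i < j -> j <= m -> pr i m <> pr j m].
  pose m := \max_(i <- s) i.
  have lem i : i \in s -> i <= m by move=> is_; apply: leq_bigmax_seq.
  have um : uniq [seq pr i m | i <- s].
    rewrite map_inj_in_uniq // => i j is_ js E.
    case: (ltngtP i j) => // lt.
      by case: (sep i j m is_ js lt (lem _ js)).
    by case: (sep j i m js is_ lt (lem _ is_)).
  have := max_card [in [seq pr i m | i <- s]].
  by rewrite (card_uniqP um) size_map szs ltnn.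
elim: (#|_|.+1) => [|K [s [us szs sep]]]; first by exists [::].
pose M := \max_(i <- s) maxn i.+1 (b i).
have leM i : i \in s -> (i < M) && (b i <= M).
  move=> is_; rewrite -geq_max.
  exact: (@leq_bigmax_seq _ s xpredT (fun i => maxn i.+1 (b i))).
exists (M :: s); split=> /=; rewrite ?szs ?us ?andbT //.
  by apply/negP => /leM; rewrite ltnn.
move=> i j m; rewrite !inE => /orP[/eqP->|is_] /orP[/eqP->|js] lt jm.
- by rewrite ltnn in lt.
- by have /andP[h _] := leM _ js; move: (ltn_trans lt h); rewrite ltnn.
- by have /andP[h1 h2] := leM _ is_; apply: bP => //; exact: ltnW.
exact: sep.
Qed.

(** The least token that ever merges with [i1] is immortal, since an older token with its profile
    would merge with [i1] as well. Infinitely many later tokens merge with it. *)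
Lemma immortal_absorber : exists i, (forall n, i <= n -> alive i n) /\
  infinitely (fun n => exists j, [/\ i < j, alive j n & pr i n.+1 = pr j n.+1]).
Proof.
have [i1 Hi1] := infinite_class.
have ex : exists i, `[< exists2 m, (i1 <= m) && (i <= m) & pr i m = pr i1 m >].
  by exists i1; apply/asboolP; exists i1; rewrite ?leqnn.
case: (ex_minnP ex) => i /asboolP[m1 /andP[l1 l2] E1] imin.
have ii1 : i <= i1 by apply: imin; apply/asboolP; exists i1; rewrite ?leqnn.
have imm n : i <= n -> alive i n.
  move=> li; apply/aliveP; split=> // i' lt E.
  suff /asboolP/imin : exists2 m, (i1 <= m) && (i' <= m) & pr i' m = pr i1 m.
    by rewrite leqNgt lt.
  exists (maxn m1 n); first by rewrite !leq_max l1 (leq_trans (ltnW lt) li) !orbT.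
  rewrite (@merged_later i' i n) ?leq_maxr ?(leq_trans (ltnW lt)) //.
  by apply: merged_later E1 => //; rewrite leq_maxl.
exists i; split=> // B.
have [j0 [Bj0 lij0 [m jm Em]]] := Hi1 (maxn B i1.+1).
have /andP[Bj lj0] : (B <= j0) && (i1 < j0) by rewrite -geq_max.
have {}lj0 : i < j0 by exact: leq_ltn_trans ii1 lj0.
have exm : exists m, (j0 <= m) && (pr i m == pr j0 m).
  exists (maxn m m1); rewrite leq_max jm /=.
  have <- : pr i1 (maxn m m1) = pr j0 (maxn m m1).
    by apply: merged_later Em => //; rewrite ?leq_maxl // (leq_trans lij0).
  by apply/eqP; apply: merged_later E1 => //; rewrite leq_maxr.
(* One step before [j0] first gets the profile of [i], the live token representing [j0] differs from
   [i]; this token is absorbed. *)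
case: (ex_minnP exm) => m' /andP[jm' /eqP E] mmin.
case: m' jm' E mmin => [|n] jn E mmin.
  by move: jn; rewrite leqn0 => /eqP j00; rewrite j00 in lj0.
have {}jn : j0 <= n.
  move: jn; rewrite leq_eqVlt => /orP[/eqP jn|//].
  have := alive_born j0; move/aliveP=> [_ /(_ _ lj0)]; rewrite {1 2}jn E.
  by rewrite jn.
have nE : pr i n <> pr j0 n.
  by move=> E'; have := mmin n; rewrite jn E' eqxx ltnn => /(_ isT).
have [j [ljj aj Ej]] := representative jn.
have E2 : pr i n.+1 = pr j n.+1.
  by rewrite E; apply: esym; apply: merged_later Ej => //; exact: leq_trans ljj jn.
exists n; split; first exact: leq_trans Bj jn.
exists j; split=> //; rewrite ltnNge leq_eqVlt; apply/negP => /orP[/eqP ji|lt].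
  by apply: nE; rewrite -ji Ej.
have /imm/aliveP[_ /(_ _ lt)] : i <= n.+1 by rewrite (leq_trans (ltnW lj0)) // leqW.
by rewrite E2.
Qed.

Variable F : {set X} -> Prop.

(* If j1 has merged with i by m1 and m1 <= j2, then pr j1 j2 = pr i j2 = e, so
   cutting at such j's gives profiles s * e, e, e, ... : neither idempotents nor
   Ramsey's theorem are needed. *)
Lemma word_accepted_tokens i s e : pr 0 i = s ->
  (forall B, exists j, [/\ B <= j, i < j, pr i j = e &
     exists2 m, j <= m & pr i m = pr j m]) ->
  word_accepted step x0 F alpha <->
  profiles_accepted x0 F (fun k => if k == 0 then pmul s e else e).
Proof.
move=> Es H; have /choice[g gP] : forall B, exists g : nat * nat,
    [/\ B <= g.1, i < g.1, pr i g.1 = e, g.1 <= g.2 & pr i g.2 = pr g.1 g.2].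
  move=> B; by have [j [h1 h2 h3 [m h4 h5]]] := H B; exists (j, m).
pose u := fix u k := if k is k'.+1 then g (u k').2.+1 else g 0.
pose c k := if k is k'.+1 then (u k').1 else 0.
have uP k : [/\ i < (u k).1, pr i (u k).1 = e, (u k).1 <= (u k).2 &
    pr i (u k).2 = pr (u k).1 (u k).2].
  by case: k => [|k]; [have [] := gP 0|have [] := gP (u k).2.+1].
have uS k : (u k).2 < (u k.+1).1 by have [] := gP (u k).2.+1.
have cS k : c k < c k.+1.
  case: k => [|k] /=; first by have [h _ _ _] := uP 0; apply: leq_ltn_trans h.
  by have [_ _ h _] := uP k; apply: leq_ltn_trans h (uS k).
rewrite (@word_accepted_cut _ _ _ _ _ c) //.
suff -> : (fun k => pr (c k) (c k.+1)) = (fun k => if k == 0 then pmul s e else e) by [].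
apply: funext => -[|k] /=.
  by have [h1 h2 _ _] := uP 0; rewrite (@pr_split _ _ _ _ 0 i) ?(ltnW h1) // Es h2.
have [h1 h2 h3 h4] := uP k; have [h5 h6 _ _] := uP k.+1; rewrite -h6.
apply: esym; apply: merged_later h4 => //; last exact: ltnW (uS k).
exact: leq_trans (ltnW h1) h3.
Qed.

End Word.

(** The automaton recognizes the rejected words: acceptance depends only on the profile [s] before
    an immortal token and on a profile [e] that recurs between its birth and those of the tokens it
    absorbs. *)
Lemma determinize (F : {set X} -> Prop) :
  exists (D : finType) (d0 : D) (delta : D -> A -> D) (G : {set {set D}}),
  forall (alpha : nat -> A) (w : nat -> D), w 0 = d0 ->
    (forall n, w n.+1 = delta (w n) (alpha n)) ->
    (infset w \in G <-> ~ word_accepted step x0 F alpha).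
Proof.
(* Deaths and absorptions happen on transitions. Keeping the last table and letter in the state
   makes the recurring events visible in the set of recurring states. *)
pose D : finType := (table * option (table * A))%type.
pose delta (d : D) a : D := (next_table d.1 a, Some (d.1, a)).
(* A position k in the age order holds an immortal token iff no token of rank at
   most k dies from some point on. *)
pose G : {set {set D}} := [set P : {set D} | `[< exists k s e,
  [/\ ~ profiles_accepted x0 F (fun k => if k == 0 then pmul s e else e),
      forall d T a, d \in P -> d.2 = Some (T, a) -> ~ token_dies T a k &
      exists d T a, [/\ d \in P, d.2 = Some (T, a) & token_absorbs T a k s e]] >]].
exists D, (table0, None), delta, G => alpha w w0 wS.
have w1 n : (w n).1 = tab alpha n.
  by elim: n => [|n IH]; rewrite ?w0 ?wS /= ?tab0 // IH tab_next.
have w2 n : (w n.+1).2 = Some (tab alpha n, alpha n) by rewrite wS /= w1.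
rewrite inE; split=> [/asboolP[k [s [e [nacc nodie [d [T [a [dP dE abs]]]]]]]]|nacc].
  have [N0 HN0] := eventually_infset w.
  have nd n : N0 <= n -> ~ token_dies (tab alpha n) (alpha n) k.
    by move=> Nn; apply: nodie (w2 n); apply: HN0; exact: leqW.
  have ev : infinitely (fun n => token_absorbs (tab alpha n) (alpha n) k s e).
    move=> N; move/infsetP/(_ N.+1): dP => [[|n] [Nn E]] //; exists n; split=> //.
    by move: dE; rewrite -E w2 => -[-> ->].
  (* After [N0] no token of rank at most [k] dies, so the token found here keeps rank [k] forever
     and makes all later absorptions at that rank. *)
  have [n1 [Nn1 /token_absorbsP[i [_ [ai _ _ _ [rk Es _]]]]]] := ev N0.
  have stab n : n1 <= n ->
      alive alpha i n /\ age_rank (tab alpha n) (pr step alpha i n) = k.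
    move/subnKC <-; elim: (n - n1) => [|m [am rm]]; first by rewrite addn0.
    have ndm : ~ token_dies (tab alpha (n1 + m)) (alpha (n1 + m)) k.
      by apply: nd; exact: leq_trans Nn1 (leq_addr _ _).
    rewrite addnS; split; first by apply: token_survives ndm => //; rewrite rm.
    by rewrite (rank_stable am _ ndm) rm.
  move=> acc; apply: nacc; apply: (proj1 (@word_accepted_tokens _ F i s e Es _) acc) => B.
  (* From [N2] on tokens born before [B] no longer die, so the absorbed token is born at [B] or
     later. *)
  have [N2 HN2] := eventually_stable alpha B.
  have [n [Nn /token_absorbsP[i' [j [ai' aj lt E [rk' _ Ee]]]]]] := ev (maxn n1 N2).
  move: Nn; rewrite geq_max => /andP[n1n N2n].
  have [ain rin] := stab _ n1n.
  have ii' : i' = i by apply: (age_rank_inj ai' ain); rewrite rk' rin.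
  subst i'; exists j; split=> //.
    rewrite leqNgt; apply/negP => jB.
    by have /aliveP[_ /(_ _ lt)] := HN2 _ N2n _ jB aj; rewrite E.
  by exists n.+1 => //; case/aliveP: aj => /leqW.
have [i [imm ev]] := immortal_absorber alpha.
have [N HN] := eventually_stable alpha i.+1.
pose M := maxn N i.
(* From [M] on no token older than [i] dies, so the rank of [i] has its final value. *)
have rkc n : M <= n -> age_rank (tab alpha n) (pr step alpha i n) =
    age_rank (tab alpha M) (pr step alpha i M).
  move/subnKC <-; elim: (n - M) => [|m IH]; first by rewrite addn0.
  have iM : i <= M + m by rewrite (leq_trans _ (leq_addr _ _)) // leq_maxr.
  rewrite addnS -IH !age_rankE; try (by apply: imm; rewrite ?(leqW iM)).
  apply: eq_in_count => j; rewrite mem_iota /= add0n => ji; apply/idP/idP.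
    by apply: alive_earlier; rewrite ?(leq_trans (ltnW ji)).
  apply: HN; rewrite ?(ltnW ji) ?ltnS ?(ltnW ji) //.
  by rewrite (leq_trans _ (leq_addr _ _)) // leq_maxl.
set k := age_rank (tab alpha M) (pr step alpha i M) in rkc.
pose s := pr step alpha 0 i.
have [|e eP] := @infinitely_pigeonhole profile (fun e n => M <= n /\ exists j,
    [/\ i < j, alive alpha j n, pr step alpha i n.+1 = pr step alpha j n.+1 &
        pr step alpha i j = e]).
  move=> B; have [n [Bn [j [h1 h2 h3]]]] := ev (maxn B M); exists n.
  move: Bn; rewrite geq_max => /andP[Bn Mn]; split=> //.
  by exists (pr step alpha i j); split=> //; exists j.
have absP n : (M <= n /\ exists j,
    [/\ i < j, alive alpha j n, pr step alpha i n.+1 = pr step alpha j n.+1 &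
        pr step alpha i j = e]) -> token_absorbs (tab alpha n) (alpha n) k s e.
  move=> [Mn [j [h1 h2 h3 h4]]]; apply/token_absorbsP; exists i, j; split=> //.
    by apply: imm; rewrite (leq_trans _ Mn) // leq_maxr.
  by split=> //; rewrite rkc.
apply/asboolP; exists k, s, e; split.
- move=> acc; apply: nacc; apply: (proj2 (@word_accepted_tokens _ F i s e erefl _) acc) => B.
  have [N2 HN2] := eventually_stable alpha B.
  have [n [Nn [Mn [j [h1 h2 h3 h4]]]]] := eP N2.
  exists j; split=> //; last by exists n.+1 => //; case/aliveP: h2 => /leqW.
  rewrite leqNgt; apply/negP => jB.
  by have /aliveP[_ /(_ _ h1)] := HN2 _ Nn _ jB h2; rewrite h3.
- move=> d T a /infsetP/(_ M.+1)[[|n] [Mn <-]] //; rewrite w2 => -[<- <-].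
  move=> /token_diesP[j [aj rj]]; apply/negP; rewrite negbK.
  have [Nn in_] : N <= n /\ i <= n.
    by move: Mn; rewrite ltnS geq_max => /andP[].
  apply: HN => //; rewrite ltnS leqNgt; apply/negP => ij.
  have := age_rank_mono (imm _ in_) aj ij; rewrite rkc //.
  by rewrite ltnNge rj.
have [|d dP] := @infinitely_pigeonhole D (fun d n => w n = d /\
    exists T a, d.2 = Some (T, a) /\ token_absorbs T a k s e).
  move=> B; have [n [Bn h]] := eP B; exists n.+1; split; first exact: leqW.
  exists (w n.+1); split=> //; exists (tab alpha n), (alpha n).
  by rewrite w2; split=> //; exact: absP.
have [n [_ [wn [T [a [h1 h2]]]]]] := dP 0.
by exists d, T, a; split=> //; apply/infsetP; apply: infinitely_sub dP => m [].
Qed.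

End Tokens.

(** * Complementation of tree automata *)

Lemma rem_cat (T : eqType) (x : T) (s1 s2 : seq T) :
  rem x (s1 ++ s2) = if x \in s1 then rem x s1 ++ s2 else s1 ++ rem x s2.
Proof.
elim: s1 => //= y s1 IH; rewrite inE eq_sym; case: eqP => //= _.
by rewrite IH; case: ifP.
Qed.

(** * From Muller to parity conditions by latest appearance records *)

Section LatestAppearance.
Variables (Q : finType) (F : {set {set Q}}).

(* With P the set of states seen infinitely often, eventually the first #|P| entries
   of the record are exactly P, and its last entry there is hit infinitely often. *)
Definition lar_priority (q : Q) (L : seq Q) : nat :=
  (index q L).*2 + ([set x in take (index q L).+1 L] \in F).

Variables (w : nat -> Q) (L : nat -> seq Q).
Hypotheses (L0 : perm_eq (L 0) (enum Q)).
Hypotheses (LS : forall n, L n.+1 = w n :: rem (w n) (L n)).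

Lemma lar_perm n : perm_eq (L n) (enum Q).
Proof.
elim: n => // n IH; rewrite LS; apply: (perm_trans _ IH); rewrite perm_sym.
by apply: perm_to_rem; rewrite (perm_mem IH) mem_enum.
Qed.

Lemma lar_uniq n : uniq (L n).
Proof. by rewrite (perm_uniq (lar_perm n)) enum_uniq. Qed.

Lemma mem_lar n q : q \in L n.
Proof. by rewrite (perm_mem (lar_perm n)) mem_enum. Qed.

(** Moving the current state to the front keeps the states seen since [N] ahead of all others. *)
Lemma lar_recent N n : N <= n -> exists A1 A2, L n = A1 ++ A2 /\
  forall x, x \in A1 <-> exists2 k, N <= k < n & w k = x.
Proof.
move/subnKC <-; elim: (n - N) => [|m [A1 [A2 [LE HA]]]].
  exists [::], (L N); rewrite addn0; split=> // x; rewrite in_nil; split=> // -[k].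
  by case: (leqP N k) => //= h; rewrite ltnNge h.
rewrite addnS LS LE; set q := w (N + m).
have key x : x = q \/ x \in A1 <-> exists2 k, N <= k < (N + m).+1 & w k = x.
  split=> [[->|/HA[k /andP[h1 h2] h3]]|[k /andP[h1]]].
  - by exists (N + m); rewrite ?leq_addr ?ltnSn.
  - by exists k => //; rewrite h1 ltnW.
  rewrite ltnS leq_eqVlt => /orP[/eqP->|h2 h3]; first by left.
  by right; apply/HA; exists k; rewrite ?h1.
have [qA|qA] := boolP (q \in A1).
  exists (q :: rem q A1), A2; split; first by rewrite rem_cat qA.
  move=> x; rewrite -key; have /perm_mem <- := perm_to_rem qA.
  by split=> [->|[->|]]; auto.
exists (q :: A1), (rem q A2); split; first by rewrite rem_cat (negbTE qA).
by move=> x; rewrite -key inE; split=> [/orP[/eqP->|]|[->|->]]; rewrite ?eqxx ?orbT; auto.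
Qed.

Lemma lar_priority_max : exists m, [/\ odd m = (infset w \in F),
  infinitely (fun n => lar_priority (w n) (L n) = m) &
  exists N, forall n, N <= n -> lar_priority (w n) (L n) <= m].
Proof.
set P := infset w; have [N0 HN0] := eventually_infset w.
have [|N1 HN1] := @eventually_seq Q (enum P)
    (fun x n => exists2 k, N0 <= k < n & w k = x).
  move=> x; rewrite mem_enum => /infsetP/(_ N0)[k [Nk wk]].
  by exists k.+1 => n kn; exists k; rewrite ?Nk.
pose N := maxn N0 N1; pose c := #|P|.
have block n : N <= n -> exists A1 A2, [/\ L n = A1 ++ A2, A1 =i P & size A1 = c].
  rewrite geq_max => /andP[Nn0 Nn1]; have [A1 [A2 [LE HA]]] := lar_recent Nn0.
  exists A1, A2; have eqi : A1 =i P.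
    move=> x; apply/idP/idP => [/HA[k /andP[h _] <-]|xP]; first exact: HN0.
    by apply/HA; apply: HN1 => //; rewrite mem_enum.
  split=> //; have /card_uniqP <- : uniq A1.
    by have := lar_uniq n; rewrite LE cat_uniq => /andP[].
  exact: eq_card.
have idx n : N <= n -> index (w n) (L n) < c.
  move=> Nn; have [A1 [A2 [-> eqi <-]]] := block _ Nn.
  have wA : w n \in A1 by rewrite eqi; apply: HN0; move: Nn; rewrite geq_max => /andP[].
  by rewrite index_cat wA index_mem.
have c0 : 0 < c by apply: leq_ltn_trans (idx N _).
pose m := (c.-1).*2 + (P \in F).
have full n : N <= n -> index (w n) (L n) = c.-1 -> lar_priority (w n) (L n) = m.
  move=> Nn E; rewrite /lar_priority /m E prednK //.
  have [A1 [A2 [-> eqi <-]]] := block _ Nn; rewrite take_size_cat //.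
  by have -> : [set x in A1] = P by apply/setP => x; rewrite inE eqi.
exists m; split.
- by rewrite /m oddD odd_double oddb.
- apply: (@infinitely_sub (fun n => N <= n /\ index (w n) (L n) = c.-1)).
    by move=> n []; exact: full.
  (* If only smaller positions were hit from then on, the entry at position [c.-1] would never move,
     so this member of [P] would not recur. *)
  apply: contrapT => /not_infinitely[N2 HN2].
  pose M := maxn N N2; have [A1 [A2 [LE eqi sz]]] := block M (leq_maxl _ _).
  have idx' n : M <= n -> index (w n) (L n) < c.-1.
    rewrite geq_max => /andP[h1 h2]; have := idx _ h1.
    rewrite -{1}(prednK c0) ltnS leq_eqVlt => /orP[/eqP E|//].
    by case: (HN2 n).
  pose z := nth (w 0) (L M) c.-1.
  have zP : z \in P by rewrite -eqi /z LE nth_cat sz prednK // leqnn mem_nth // sz prednK.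
  have zn n : M <= n -> nth (w 0) (L n) c.-1 = z.
    move/subnKC <-; elim: (n - M) => [|k IH]; first by rewrite addn0.
    rewrite addnS LS -IH; have := idx' (M + k) (leq_addr _ _).
    set i := index _ _; rewrite remE -/i.
    case: (c.-1) => [//|d]; rewrite ltnS => di /=.
    have il : i < size (L (M + k)) by rewrite index_mem mem_lar.
    rewrite nth_cat size_take il ltnNge di /= nth_drop addSn subnKC //.
  have /infsetP/(_ M)[n [Mn wn]] := zP.
  have := idx' n Mn; rewrite wn -(zn n Mn) index_uniq ?ltnn ?lar_uniq //.
  have -> : size (L n) = #|Q| by rewrite (perm_size (lar_perm n)) -cardE.
  by rewrite prednK // max_card.
exists N => n Nn; have := idx _ Nn; rewrite -{1}(prednK c0) ltnS leq_eqVlt.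
move=> /orP[/eqP E|lt]; first by rewrite full.
rewrite /lar_priority; apply: leq_trans (leq_addr _ _).
by apply: (@leq_trans (index (w n) (L n)).+1.*2); rewrite ?leq_double // doubleS;
  case: (_ \in F); rewrite ?addn1 ?addn0 // ltnW.
Qed.

End LatestAppearance.

(** * The acceptance game and the advice of the pathfinder *)

Section Complement.
Variables (S Q : finType) (q0 : Q) (Delta : Q -> S -> Q -> Q -> bool).
Variable F : {set {set Q}}.

Definition lar := #|Q|.-tuple Q.
Definition lar0 : lar := enum_tuple Q.
(** [insubd] returns [L] if the length is wrong, which does not occur for [q] in [L]. *)
Definition lar_step (L : lar) (q : Q) : lar := insubd L (q :: rem q L).

Definition lar_run (w : nat -> Q) : nat -> lar :=
  fix lr n := if n is n'.+1 then lar_step (lr n') (w n') else lar0.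

Lemma val_lar_step (L : lar) q : q \in tval L -> lar_step L q = q :: rem q L :> seq Q.
Proof.
move=> qL; rewrite /lar_step val_insubd /= size_rem // size_tuple.
by rewrite prednK ?eqxx //; apply/card_gt0P; exists q.
Qed.

Lemma lar_run_perm w n : perm_eq (lar_run w n) (enum Q).
Proof.
elim: n => [|n IH] //=; have h : w n \in tval (lar_run w n).
  by rewrite (perm_mem IH) mem_enum.
rewrite val_lar_step //; apply: (perm_trans _ IH); rewrite perm_sym; exact: perm_to_rem.
Qed.

Lemma lar_run_max w : exists m, [/\ odd m = (infset w \in F),
  infinitely (fun n => lar_priority F (w n) (lar_run w n) = m) &
  exists N, forall n, N <= n -> lar_priority F (w n) (lar_run w n) <= m].
Proof.
apply: (@lar_priority_max Q F w (fun n => lar_run w n)); first exact: lar_run_perm 0.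
by move=> n; rewrite val_lar_step // (perm_mem (lar_run_perm w n)) mem_enum.
Qed.

Definition config := (Q * lar)%type.

(* A position of the acceptance game is [Some (u, c, None)] when the automaton is
   to choose a transition at node u, [Some (u, c, Some p)] when the pathfinder is
   to choose one of the two children after transition p was chosen, and [None]
   once the automaton got stuck. *)
Definition position := option (seq bool * config * option (Q * Q)).

Variable t : tree S.

Definition game_owner (v : position) : bool := if v is Some (_, _, Some _) then false else true.

Definition game_succ (v : position) : seq position :=
  match v with
  | None => [:: None]
  | Some (u, (q, L), None) =>
    let s : seq position := [seq Some (u, (q, L), Some p) |
      p <- enum {: Q * Q} & Delta q (t u) p.1 p.2] in
    if s is [::] then [:: None] else s
  | Some (u, (q, L), Some p) =>
    [:: Some (false :: u, (p.1, lar_step L q), None);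
        Some (true :: u, (p.2, lar_step L q), None)]
  end.

(** Priority 0 is the least, so pathfinder positions do not affect the limit superior; it is also
    even, so the automaton loses at [None]. *)
Definition game_priority (v : position) : nat :=
  if v is Some (_, (q, L), None) then lar_priority F q L else 0.

Lemma game_succ_total v : exists v', v' \in game_succ v.
Proof.
case: v => [[[u [q L]] [p|]]|] /=; last by exists None; rewrite inE.
  by eexists; apply: mem_head.
by case: [seq _ | _ <- _ & _] => [|v s]; eexists; apply: mem_head.
Qed.

Lemma game_succ_some u q L v' : v' \in game_succ (Some (u, (q, L), None)) ->
  v' = None \/ exists2 p, v' = Some (u, (q, L), Some p) & Delta q (t u) p.1 p.2.
Proof.
rewrite /=; set s := [seq _ | _ <- _ & _].
have sP x : x \in s -> exists2 p, x = Some (u, (q, L), Some p) & Delta q (t u) p.1 p.2.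
  by move=> /mapP[p]; rewrite mem_filter => /andP[h _] ->; exists p.
by case: s sP => [|v s] sP; [rewrite inE => /eqP ->; left|move=> /sP ?; right].
Qed.

Lemma game_succ_delta u q L p : Delta q (t u) p.1 p.2 ->
  Some (u, (q, L), Some p) \in game_succ (Some (u, (q, L), None)).
Proof.
move=> D; rewrite /=; set s := [seq _ | _ <- _ & _].
have : Some (u, (q, L), Some p) \in s.
  by apply/mapP; exists p => //; rewrite mem_filter D mem_enum.
by case: s.
Qed.

Definition branch_play (pi : nat -> bool) (w : nat -> Q) (pq : nat -> Q * Q) (n : nat) : position :=
  Some (node_at pi n./2, (w n./2, lar_run w n./2), if odd n then Some (pq n./2) else None).

(** A tree level takes two moves. At even times the priorities are those of the record, whose limit
    superior is odd iff the Muller condition holds, and no play is won by both players. *)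
Lemma branch_play_won b pi w pq :
  parity_won game_priority b (branch_play pi w pq) -> (infset w \in F) = b.
Proof.
move=> won; have [m [mF im [N HN]]] := lar_run_max w.
suff won' : parity_won game_priority (infset w \in F) (branch_play pi w pq).
  case: (infset w \in F) b won won' => [] [] // h1 h2.
    by case: (parity_won_contra h2 h1).
  by case: (parity_won_contra h1 h2).
exists m; split=> //.
  move=> k; have [n [kn E]] := im k; exists n.*2; split.
    by apply: leq_trans kn _; rewrite -addnn leq_addr.
  by rewrite /branch_play doubleK odd_double.
exists N.*2 => n Nn; rewrite /branch_play /=; case: (odd n) => //.
by apply: HN; rewrite -(doubleK N) half_leq.
Qed.

Definition accepting_run_exists : Prop :=
  exists rho, is_run q0 Delta t rho /\ muller_accepting F rho.

Notation won := (paddock game_owner game_succ game_priority).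
Definition start : position := Some ([::], (q0, lar0), None).

(** A positional strategy prescribes one transition at each node reached; these form a run, every
    branch of which is a play of the strategy. *)
Lemma automaton_strategy (W : position -> Prop) s :
  won true (fun _ => True) W s -> W start -> accepting_run_exists.
Proof.
move=> [_ Ws Wo Wwin] Wstart.
have WNone : ~ W None.
  move=> Wn; have [h _] := Ws _ Wn erefl; move: h; rewrite inE => /eqP sN.
  have [m [mo im _]] : parity_won game_priority true (fun _ => None).
    by apply: Wwin => // n; rewrite inE sN.
  by have [_ [_ E]] := im 0; rewrite -E in mo.
(* The fallback [conf u'] is never reached, as inside [W] the strategy always selects a
   transition. *)
pose conf := fix conf (u : node) : config := if u is d :: u' then
    if s (Some (u', conf u', None)) is Some (_, _, Some p) then
      (if d then p.2 else p.1, lar_step (conf u').2 (conf u').1)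
    else conf u'
  else (q0, lar0).
have key u : W (Some (u, conf u, None)) -> exists p,
    [/\ s (Some (u, conf u, None)) = Some (u, conf u, Some p),
        W (Some (u, conf u, Some p)) & Delta (conf u).1 (t u) p.1 p.2].
  move=> Wu; have [h1 h2] := Ws _ Wu erefl; case E : (conf u) h1 h2 => [q L] h1 h2.
  have [E'|[p E' D]] := game_succ_some h1; first by rewrite E' in h2.
  by exists p; rewrite E' in h2 *.
have confS u d p : s (Some (u, conf u, None)) = Some (u, conf u, Some p) ->
    conf (d :: u) = (if d then p.2 else p.1, lar_step (conf u).2 (conf u).1).
  by move=> /= ->.
have Wconf u : W (Some (u, conf u, None)).
  elim: u => // d u IH; have [p [E Wp D]] := key u IH.
  rewrite (confS _ _ _ E); apply: (Wo _ Wp) => //.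
  by case: (conf u) => q L; case: d; rewrite /= !inE eqxx ?orbT.
have /choice[tr trP] : forall u, exists p,
    [/\ s (Some (u, conf u, None)) = Some (u, conf u, Some p),
        W (Some (u, conf u, Some p)) & Delta (conf u).1 (t u) p.1 p.2].
  by move=> u; apply: key.
pose rho u := (conf u).1.
have rhoS u d : rho (d :: u) = if d then (tr u).2 else (tr u).1.
  by have [E _ _] := trP u; rewrite /rho (confS _ _ _ E).
exists rho; split.
  by split=> // u; rewrite !rhoS; have [] := trP u.
apply/muller_acceptingE => pi.
pose w n := rho (node_at pi n).
have confE n : conf (node_at pi n) = (w n, lar_run w n).
  elim: n => // n IH; have [E _ _] := trP (node_at pi n).
  have := confS _ (pi n) _ E; rewrite IH => E'.
  rewrite [LHS]surjective_pairing; congr (_, _).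
  by rewrite [node_at _ _]/= E'.
rewrite -/w; apply: (@branch_play_won true pi w (fun n => tr (node_at pi n))).
apply: Wwin => n; rewrite /branch_play -confE.
  by case: (odd n) => //; have [] := trP (node_at pi n./2).
have [E Wp D] := trP (node_at pi n./2).
rewrite -!confE /= uphalf_half; case: (odd n) => /=; last first.
  rewrite add0n E; split=> //; case Ec : (conf _) D => [q L] D.
  exact: game_succ_delta.
split=> //; rewrite !add0n E.
by case: (conf _) => q L; case: (pi _); rewrite !inE eqxx ?orbT.
Qed.

(** The part of a positional pathfinder strategy at one node: a direction ([true] for right) for
    every configuration and chosen transition. Its type is finite, so an automaton can guess it. *)
Definition advice := {ffun config * (Q * Q) -> bool}.

(** Only transitions that the advice sends in the direction of the branch are followed, so a branch
    word is accepted when the automaton beats the advice along that branch. *)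
Definition consistent (a : S * advice * bool) (c c' : config) : bool :=
  [exists p : Q * Q, [&& Delta c.1 a.1.1 p.1 p.2, a.1.2 (c, p) == a.2 &
     c' == (if a.2 then p.2 else p.1, lar_step c.2 c.1)]].

Definition config_accepting (P : {set config}) : Prop := fst @: P \in F.

Definition branch_word (f : node -> advice) (pi : nat -> bool) (n : nat) :=
  (t (node_at pi n), f (node_at pi n), pi n).

Definition refutes (f : node -> advice) : Prop := forall pi,
  ~ word_accepted (fun c a c' => consistent a c c') (q0, lar0) config_accepting
     (branch_word f pi).

Lemma consistent_run (r : nat -> config) (alpha : nat -> S * advice * bool) : r 0 = (q0, lar0) ->
  (forall n, consistent (alpha n) (r n) (r n.+1)) ->
  r = fun n => ((r n).1, lar_run (fst \o r) n).
Proof.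
move=> r0 rS; apply: funext; elim=> [|n IH]; first by rewrite r0.
have /existsP[p /and3P[_ _ /eqP E]] := rS n.
by rewrite [LHS]surjective_pairing; congr (_, _); rewrite {1}E /= {1}IH.
Qed.

(** The advice is the winning strategy itself; configurations beating it along a branch would form a
    play won by the pathfinder. *)
Lemma pathfinder_strategy (W : position -> Prop) s :
  won false (fun _ => True) W s -> W start -> exists f, refutes f.
Proof.
move=> [_ Ws Wo Wwin] Wstart.
pose f u : advice := [ffun x => s (Some (u, x.1, Some x.2)) ==
  Some (true :: u, (x.2.2, lar_step x.1.2 x.1.1), None)].
exists f => pi [r [r0 rS rF]].
pose w := fst \o r; have rE := consistent_run r0 rS.
have /choice[pq pqP] : forall n, exists p : Q * Q,
    [/\ Delta (w n) (t (node_at pi n)) p.1 p.2,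
        f (node_at pi n) ((w n, lar_run w n), p) = pi n &
        w n.+1 = if pi n then p.2 else p.1].
  move=> n; have /existsP[p /and3P[h1 /eqP h2 /eqP h3]] := rS n; exists p; split=> //.
    have <- : r n = (w n, lar_run w n) by rewrite {1}rE.
    exact: h2.
  by rewrite /w /= h3.
have W1 n : W (Some (node_at pi n, (w n, lar_run w n), None)) ->
    W (Some (node_at pi n, (w n, lar_run w n), Some (pq n))).
  move=> Wn; apply: (Wo _ Wn) => //; apply: game_succ_delta; by have [] := pqP n.
have next n : W (Some (node_at pi n, (w n, lar_run w n), Some (pq n))) ->
    s (Some (node_at pi n, (w n, lar_run w n), Some (pq n))) =
    Some (node_at pi n.+1, (w n.+1, lar_run w n.+1), None).
  move=> Wn; have [_ + ->] := pqP n; have [+ _] := Ws _ Wn erefl.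
  rewrite ffunE /= !inE => /orP[/eqP->|/eqP->]; last by rewrite eqxx => <-.
  by case: eqP => [[]//|_ <-].
have W0 n : W (Some (node_at pi n, (w n, lar_run w n), None)).
  elim: n => [|n IH]; first by rewrite /w /= r0.
  by have Wn := W1 n IH; have [_] := Ws _ Wn erefl; rewrite next.
suff wF : (infset w \in F) = false.
  by move: rF; rewrite /config_accepting -infset_map -/w wF.
apply: (@branch_play_won false pi w pq); apply: Wwin => n.
  by rewrite /branch_play; case: (odd n); auto.
rewrite /branch_play /= uphalf_half; case: (odd n) => /=; last first.
  by rewrite add0n; split=> //; apply: game_succ_delta; have [] := pqP n./2.
rewrite add1n next; last exact: W1.
split=> //; have [_ _] := pqP n./2; rewrite /= => ->.
by case: (pi _); rewrite !inE eqxx ?orbT.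
Qed.

(** Playing an accepting run against the advice singles out a branch, along which the run beats the
    advice. *)
Lemma refutes_rejects f : refutes f -> ~ accepting_run_exists.
Proof.
move=> rf [rho [[rho0 rhoS] /muller_acceptingE acc]].
pose out (x : node * lar) : bool :=
  f x.1 ((rho x.1, x.2), (rho (false :: x.1), rho (true :: x.1))).
pose st := fix st n : node * lar := if n is n'.+1 then
  (out (st n') :: (st n').1, lar_step (st n').2 (rho (st n').1)) else ([::], lar0).
pose pi n := out (st n).
have nodeE n : node_at pi n = (st n).1 by elim: n => //= n ->.
apply: (rf pi); exists (fun n => (rho (st n).1, (st n).2)); split.
- by rewrite /= rho0.
- move=> n; apply/existsP; exists (rho (false :: (st n).1), rho (true :: (st n).1)).
  rewrite /branch_word nodeE /= rhoS eqxx /= /pi; by case: (out _).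
rewrite /config_accepting -infset_map; have := acc pi; congr (infset _ \in F).
by apply: funext => n; rewrite /= nodeE.
Qed.

Lemma refutesP : (exists f, refutes f) <-> ~ accepting_run_exists.
Proof.
split=> [[f]|nacc]; first exact: refutes_rejects.
have [||W [s [pd cov]]] := @parity_determined position game_owner game_succ
    game_priority (#|Q|.*2.+2) (fun _ => True).
- by move=> v _; have [v'] := game_succ_total v; exists v'.
- case=> [[[u [q L]] [p|]]|] //= _; rewrite /lar_priority.
  have h : index q L <= #|Q| by have := index_size q (tval L); rewrite size_tuple.
  rewrite ltnS; apply: (@leq_trans (#|Q|.*2 + 1)); last by rewrite addn1.
  by apply: leq_add; rewrite ?leq_double //; case: (_ \in _).
have [[] Wb] := cov start I.
  by case: nacc; apply: automaton_strategy (pd true) Wb.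
exact: pathfinder_strategy (pd false) Wb.
Qed.

End Complement.

(** The new automaton guesses the advice in its transition relation and runs the word automaton down
    all branches at once; determinism makes its states agree on shared prefixes. *)
Lemma muller_complement (S : finType) (L : tree S -> Prop) :
  muller_recognizable L -> muller_recognizable (fun t => ~ L t).
Proof.
move=> [Q [q0 [Delta [F LE]]]].
have [D [d0 [delta [G detP]]]] := @determinize _ _
  (fun c a c' => @consistent S Q Delta a c c') (q0, lar0 Q) (config_accepting F).
exists D, d0, (fun d a d1 d2 => [exists g : advice Q,
  (d1 == delta d (a, g, false)) && (d2 == delta d (a, g, true))]), G => t.
have -> : (~ L t) <-> exists f, refutes q0 Delta F t f.
  by rewrite LE; apply: iff_sym; exact: refutesP.
split=> [[f rf]|[rho [[rho0 rhoS] /muller_acceptingE acc]]].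
  pose rho := fix rho (u : node) : D := if u is d :: u' then
    delta (rho u') (t u', f u', d) else d0.
  exists rho; split.
    by split=> // u; apply/existsP; exists (f u); rewrite !eqxx.
  apply/muller_acceptingE => pi.
  exact/(detP (branch_word t f pi) (rho \o node_at pi) erefl _).2/rf.
have /choice[f fP] : forall u, exists g : advice Q,
    (rho (false :: u) == delta (rho u) (t u, g, false)) &&
    (rho (true :: u) == delta (rho u) (t u, g, true)).
  by move=> u; apply/existsP; exact: rhoS.
exists f => pi; apply/(detP (branch_word t f pi) (rho \o node_at pi) rho0 _).1/acc.
move=> n; rewrite /branch_word /=; have /andP[/eqP h1 /eqP h2] := fP (node_at pi n).
by case: (pi n).
Qed.

(** * Projections of closed sets *)

Lemma size_node_at pi n : size (node_at pi n) = n.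
Proof. by elim: n => //= n ->. Qed.

Definition nodes_upto (m : nat) : seq node :=
  flatten [seq [seq tval x | x <- enum {: k.-tuple bool}] | k <- iota 0 m.+1].

Lemma mem_nodes_upto m (u : node) : size u <= m -> u \in nodes_upto m.
Proof.
move=> um; apply/flattenP.
exists [seq tval x | x <- enum {: (size u).-tuple bool}].
  by apply/mapP; exists (size u); rewrite // mem_iota.
by apply/mapP; exists (in_tuple u) => //; rewrite mem_enum.
Qed.

Section Projections.
Variable S : finType.

(** Closedness in the product topology with discrete factors. *)
Definition tree_closed (I : eqType) (C : tree S -> (I -> nat) -> Prop) : Prop :=
  forall t y, (forall (a : seq node) (b : seq I), exists t' y',
    [/\ C t' y', {in a, t =1 t'} & {in b, y =1 y'}]) -> C t y.

Definition analytic (P : tree S -> Prop) : Prop :=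
  exists C : tree S -> (nat -> nat) -> Prop,
    tree_closed C /\ forall t, P t <-> exists y, C t y.

Lemma analytic_count (I : countType) (C : tree S -> (I -> nat) -> Prop) P :
  tree_closed C -> (forall t, P t <-> exists y, C t y) -> analytic P.
Proof.
move=> clC PE; exists (fun t z => C t (z \o pickle)); split.
  move=> t z H; apply: clC => a b; have [t' [y' [h1 h2 h3]]] := H a (map pickle b).
  exists t', (y' \o pickle); split=> // i ib /=; apply: h3; exact: map_f.
move=> t; rewrite PE; split=> [[y Cy]|[z Cz]]; last by exists (z \o pickle).
exists (fun n => if unpickle n is Some i then y i else 0).
by have -> : (fun n => if unpickle n is Some i then y i else 0) \o pickle = y
  by apply: funext => i /=; rewrite pickleK.
Qed.

Lemma tree_closed_all (I : eqType) (J : Type) (C : J -> tree S -> (I -> nat) -> Prop) :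
  (forall j, tree_closed (C j)) -> tree_closed (fun t y => forall j, C j t y).
Proof.
move=> clC t y H j; apply: clC => a b; have [t' [y' [h1 h2 h3]]] := H a b.
by exists t', y'.
Qed.

(** The coordinates may depend on the point, which covers conditions whose search bound is itself a
    value of [y]. *)
Lemma tree_closed_local (I : eqType) (C : tree S -> (I -> nat) -> Prop) :
  (forall t y, exists (a : seq node) (b : seq I), forall t' y',
     {in a, t =1 t'} -> {in b, y =1 y'} -> C t' y' -> C t y) -> tree_closed C.
Proof.
by move=> loc t y H; have [a [b ab]] := loc t y; have [t' [y' [/ab]]] := H a b; auto.
Qed.

Lemma analytic_bigcup (P : nat -> tree S -> Prop) :
  (forall i, analytic (P i)) -> analytic (fun t => exists i, P i t).
Proof.
move=> /choice[C CP].
apply: (@analytic_count (option nat) (fun t y => C (y None) t (y \o Some))).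
  move=> t y H; have [cl _] := CP (y None); apply: cl => a b.
  have [t' [y' [h1 h2 h3]]] := H a (None :: map Some b).
  exists t', (y' \o Some); rewrite [y None]h3 ?mem_head //; split=> // i ib.
  by apply: h3; rewrite inE map_f ?orbT.
move=> t; split=> [[i Pit]|[y Cy]]; last by exists (y None); apply/(CP _).2; exists (y \o Some).
have [y Cy] := ((CP i).2 t).1 Pit.
by exists (fun o => if o is Some n then y n else i).
Qed.

Lemma analytic_bigcap (P : nat -> tree S -> Prop) :
  (forall i, analytic (P i)) -> analytic (fun t => forall i, P i t).
Proof.
move=> /choice[C CP].
apply: (@analytic_count (nat * nat)%type (fun t y => forall i, C i t (fun k => y (i, k)))).
  apply: tree_closed_all => i t y H; have [cl _] := CP i; apply: cl => a b.
  have [t' [y' [h1 h2 h3]]] := H a (map (pair i) b).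
  by exists t', (fun k => y' (i, k)); split=> // k kb; apply: h3; rewrite map_f.
move=> t; split=> [Pt|[y Cy] i]; last by apply/(CP i).2; eexists; exact: Cy.
have /choice[y yP] : forall i, exists y, C i t y by move=> i; apply/(CP i).2.
by exists (fun c => y c.1 c.2).
Qed.

(** * A tree diagonalizing against a closed set *)

Section Diagonal.
Variables (a b : S) (ab : a != b).

Definition some_branch_often (t : tree S) : Prop :=
  exists pi, infinitely (fun n => t (node_at pi n) = a).

(* A branch r^(y 0) l r^(y 1) l ... of the tree encodes the sequence y. *)
Fixpoint decode (u : node) : seq nat * nat :=
  match u with
  | [::] => ([::], 0)
  | true :: u' => ((decode u').1, (decode u').2.+1)
  | false :: u' => (rcons (decode u').1 (decode u').2, 0)
  end.

Variable C : tree S -> (nat -> nat) -> Prop.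
Hypothesis clC : tree_closed C.

(** A left step marks a completed entry of the encoded sequence. Only nodes shallower than [u] are
    consulted, which makes the definition of the diagonal tree well founded. *)
Definition promising (t : tree S) (u : node) : Prop :=
  if u is false :: _ then exists t' y, [/\ C t' y,
    forall v, size v < size u -> t v = t' v &
    forall i, i < size (decode u).1 -> y i = nth 0 (decode u).1 i]
  else False.

Lemma promising_ext t1 t2 u : (forall v, size v < size u -> t1 v = t2 v) ->
  promising t1 u <-> promising t2 u.
Proof.
move=> E; case: u E => // -[] // u E; split=> -[t' [y [h1 h2 h3]]];
  exists t', y; split=> // v vu; rewrite -h2 ?E //.
Qed.

Fixpoint diag_approx (n : nat) : tree S := fun u =>
  if n is n'.+1 then if `[< promising (diag_approx n') u >] then a else b else b.

Definition diag : tree S := fun u => diag_approx (size u).+1 u.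

Lemma diag_approx_stable n m u : size u < n -> size u < m ->
  diag_approx n u = diag_approx m u.
Proof.
elim: n m u => // n IH [//|m] u; rewrite !ltnS => un um /=.
have /promising_ext/asbool_equiv_eq -> // : forall v, size v < size u ->
  diag_approx n v = diag_approx m v.
by move=> v vu; apply: IH; exact: leq_trans vu _.
Qed.

Lemma diagE u : diag u = if `[< promising diag u >] then a else b.
Proof.
rewrite {1}/diag /=.
have /promising_ext/asbool_equiv_eq -> // : forall v, size v < size u ->
  diag_approx (size u) v = diag v.
by move=> v vu; apply: diag_approx_stable.
Qed.

Lemma diag_promising u : diag u = a <-> promising diag u.
Proof.
rewrite diagE; case: asboolP => h; split=> // E.
by move: ab; rewrite E eqxx.
Qed.

Definition encode_state (y : nat -> nat) : nat -> nat * nat := fix st n :=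
  if n is n'.+1 then
    if (st n').2 < y (st n').1 then ((st n').1, (st n').2.+1) else ((st n').1.+1, 0)
  else (0, 0).

Definition encode (y : nat -> nat) (n : nat) : bool :=
  (encode_state y n).2 < y (encode_state y n).1.

Lemma decode_encode y n :
  decode (node_at (encode y) n) = (mkseq y (encode_state y n).1, (encode_state y n).2) /\
  (encode_state y n).2 <= y (encode_state y n).1.
Proof.
elim: n => [|n [IH1 IH2]] //=; rewrite {1}/encode.
case: ltnP => h; rewrite /= IH1 /=; split=> //.
rewrite mkseqS.
by congr (rcons _ _, _); apply/eqP; rewrite eqn_leq IH2.
Qed.

Lemma encode_often y N : exists n, N <= n /\ encode y n = false.
Proof.
(* Induction on the number of right steps left before the current entry is complete. *)
move: {2}(y _ - _) (leqnn (y (encode_state y N).1 - (encode_state y N).2)) => k.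
elim: k N => [|k IH] N.
  by rewrite leqn0 subn_eq0 => h; exists N; rewrite /encode ltnNge h.
move=> h; case E : (encode y N); last by exists N.
have [|n [Nn En]] := IH N.+1; last by exists n; split=> //; exact: ltnW.
by rewrite /=; move: (E); rewrite /encode => -> /=; rewrite subnS; case: (_ - _) h.
Qed.

Lemma decode_prefix pi n m : n <= m -> exists s,
  (decode (node_at pi m)).1 = (decode (node_at pi n)).1 ++ s.
Proof.
move/subnKC <-; elim: (m - n) => [|k [s IH]].
  by exists [::]; rewrite addn0 cats0.
rewrite addnS /=; case: (pi _) => /=; first by exists s.
by eexists; rewrite IH -cats1 -catA.
Qed.

(** Infinitely many [a] on a branch give infinitely many promising nodes; each completes an entry,
    so a whole sequence is decoded and closedness applies. Conversely, if [C diag y], then [diag]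
    and [y] themselves make every left step on the branch encoding [y] promising. *)
Lemma diagonal : some_branch_often diag <-> exists y, C diag y.
Proof.
split=> [[pi ipi]|[y Cy]].
  pose s n := (decode (node_at pi n)).1.
  have ipr : infinitely (fun n => promising diag (node_at pi n)).
    by apply: infinitely_sub ipi => n; apply: (proj1 (diag_promising _)).
  have smono n m : n <= m -> size (s n) <= size (s m).
    by move=> /(decode_prefix pi)[s' E]; rewrite /s E size_cat leq_addr.
  have sub K : exists n, K <= size (s n).
    elim: K => [|K [n Kn]]; first by exists 0.
    have [[|m] [nm]] := ipr n.+1; first by [].
    rewrite /=; case E : (pi m) => // _; exists m.+1.
    by rewrite /s /= E /= size_rcons ltnS (leq_trans Kn) // smono.
  have snth n m i : i < size (s n) -> i < size (s m) -> nth 0 (s n) i = nth 0 (s m) i.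
    wlog nm : n m / n <= m => [H|].
      by move=> h1 h2; case/orP: (leq_total n m) => /H HH; [|apply: esym]; exact: HH.
    by move=> h1 h2; have [s' E] := decode_prefix pi nm; rewrite /s E nth_cat h1.
  have /choice[g gP] : forall i, exists n, i < size (s n) by move=> i; exact: sub.
  exists (fun i => nth 0 (s (g i)) i); apply: clC => la lb.
  have [k kP] := sub (\max_(i <- lb) i).+1.
  have [n [nP]] := ipr (maxn k (\max_(v <- la) size v).+1).
  move: nP; rewrite geq_max => /andP[kn ln].
  have sz := size_node_at pi n.
  case E : (node_at pi n) sz => [//|[//|] u] sz [t' [y [h1 h2 h3]]].
  exists t', y; split=> //.
    move=> v va; apply: h2; rewrite sz; apply: leq_trans ln.
    by rewrite ltnS (leq_bigmax_seq _ va).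
  move=> i ib; have isn : i < size (s n).
    apply: leq_trans (smono _ _ kn); apply: leq_trans kP.
    by rewrite ltnS (@leq_bigmax_seq _ lb xpredT (fun i => i)).
  by rewrite h3 -E //; exact: snth.
exists (encode y) => N; have [n [Nn En]] := encode_often y N.
exists n.+1; split; first exact: leqW.
apply/diag_promising.
have E : node_at (encode y) n.+1 = false :: node_at (encode y) n by rewrite /= En.
have [+ _] := decode_encode y n.+1; rewrite E => h3.
exists diag, y; split=> // i; rewrite h3 size_mkseq => h; by rewrite nth_mkseq.
Qed.

End Diagonal.

Lemma not_analytic_no_branch_often (a b : S) : a != b ->
  ~ analytic (fun t => ~ some_branch_often a t).
Proof.
move=> ab [C [clC CP]]; have D := diagonal ab clC; have := CP (diag a b C).
by rewrite -D; case: (pselect (some_branch_often a (diag a b C))) => h [h1 h2]; tauto.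
Qed.

End Projections.

(** * Buchi automata *)

Lemma node_at_ext pi pi' n : (forall k, k < n -> pi k = pi' k) -> node_at pi n = node_at pi' n.
Proof.
elim: n => //= n IH H; rewrite H // IH // => k kn; apply: H; exact: ltnW.
Qed.

(** König's lemma: if no depth worked, the nodes through which [P] can be avoided up to any level
    would contain an infinite branch avoiding [P]. *)
Lemma branch_bar (P : node -> Prop) N :
  (forall pi, exists n, N <= n /\ P (node_at pi n)) ->
  exists m, forall pi, exists n, N <= n <= m /\ P (node_at pi n).
Proof.
move=> H; apply: contrapT => /forallNP nobar.
pose bad u := forall m, exists pi, node_at pi (size u) = u /\
  forall n, N <= n <= m -> ~ P (node_at pi n).
have bad0 : bad [::].
  move=> m; have /existsNP[pi /forallNP Hpi] := nobar m.
  by exists pi; split=> // n nm Pn; apply: (Hpi n).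
have /choice[nx nxP] : forall u, exists d, bad u -> bad (d :: u).
  move=> u; have [bu|] := pselect (bad u); last by exists true.
  have [b1|/existsNP[m1 nb1]] := pselect (bad (true :: u)); first by exists true.
  (* A branch avoiding [P] up to both bounds cannot turn right, since [m1] excludes that. *)
  exists false => _ m; have [pi [piu Hpi]] := bu (maxn m m1).
  exists pi; split=> [|n /andP[h1 h2]]; last by apply: Hpi; rewrite h1 leq_max h2.
  rewrite /= piu; case E : (pi (size u)) => //; case: nb1; exists pi.
  rewrite /= piu E; split=> // n /andP[h1 h2]; apply: Hpi.
  by rewrite h1 leq_max h2 orbT.
pose br := fix br n : node := if n is n'.+1 then nx (br n') :: br n' else [::].
pose pi n := nx (br n).
have brE n : node_at pi n = br n by elim: n => //= n ->.
have badbr n : bad (br n) by elim: n => //= n; exact: nxP.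
have [n [Nn Pn]] := H pi; have [pi' []] := badbr n n.
rewrite -brE size_node_at => E; move=> /(_ n); rewrite E Nn leqnn => /(_ isT); exact.
Qed.

(** States are natural numbers, so that automata with different state sets share one type and runs
    can be coded in sequences of numbers. *)
Record buchi_automaton (S : Type) := BuchiAutomaton {
  b_size : nat;
  b_init : nat;
  b_trans : nat -> S -> nat -> nat -> bool;
  b_final : nat -> bool }.

Section Buchi.
Variable S : finType.
Implicit Types (B : buchi_automaton S) (t : tree S) (rho : node -> nat).

Definition b_run B t rho : Prop := rho [::] = b_init B /\
  forall u, rho u < b_size B /\ b_trans B (rho u) (t u) (rho (false :: u)) (rho (true :: u)).

Definition b_accepting B rho : Prop :=
  forall pi, infinitely (fun n => b_final B (rho (node_at pi n))).

Definition b_accepts B t : Prop := exists rho, b_run B t rho /\ b_accepting B rho.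

Lemma buchi_acceptingE (Q : finType) (Qf : {set Q}) (rho : node -> Q) :
  buchi_accepting Qf rho <-> forall pi, infinitely (fun n => rho (node_at pi n) \in Qf).
Proof.
split=> H pi.
  by have [q [qf iq]] := H pi => N; have [n [Nn E]] := iq N; exists n; rewrite E.
have [|q iq] := @infinitely_pigeonhole Q (fun q n => rho (node_at pi n) = q /\ q \in Qf).
  by apply: infinitely_sub (H pi) => n h; exists (rho (node_at pi n)).
exists q; split; first by have [n [_ []]] := iq 0.
by apply: infinitely_sub iq => n [].
Qed.

Lemma buchi_code (L : tree S -> Prop) : buchi_recognizable L ->
  exists B, forall t, L t <-> b_accepts B t.
Proof.
move=> [Q [q0 [Delta [Qf LE]]]]; pose g p := nth q0 (enum Q) p.
pose f (q : Q) := index q (enum Q).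
have gf : cancel f g by move=> q; rewrite /g /f nth_index // mem_enum.
have fsz q : f q < #|Q| by rewrite cardE index_mem mem_enum.
exists (BuchiAutomaton #|Q| (f q0) (fun p a p1 p2 => Delta (g p) a (g p1) (g p2))
  (fun p => g p \in Qf)) => t; rewrite LE; split.
  move=> [rho [[r0 rS] /buchi_acceptingE acc]]; exists (f \o rho); split.
    by split=> [|u] /=; rewrite ?r0 // !gf.
  by move=> pi; apply: infinitely_sub (acc pi) => n /=; rewrite gf.
move=> [rho [[r0 rS] acc]]; exists (g \o rho); split.
  by split=> [|u] /=; [rewrite r0 /= gf|have [] := rS u].
by apply/buchi_acceptingE => pi; apply: infinitely_sub (acc pi).
Qed.

(** The state also carries its node down to depth [d], and [None] below, so a finite automaton can
    perform the checks. *)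
Lemma buchi_constrained B (d : nat) (chk : node -> nat -> S -> bool) :
  buchi_recognizable (fun t => exists rho, [/\ b_run B t rho, b_accepting B rho &
    forall u, size u <= d -> chk u (rho u) (t u)]).
Proof.
pose N := b_size B.
pose Q : finType := ('I_N.+1 * option {bseq d of bool})%type.
pose child (o : option {bseq d of bool}) (b : bool) : option {bseq d of bool} :=
  if o is Some u then insub (b :: val u) else None.
pose start : Q := (inord (b_init B), insub [::]).
(* The guard [b_init B < N] ensures that [inord] does not alter the initial state. *)
pose Delta (q : Q) (a : S) (q1 q2 : Q) := [&& b_init B < N, q.1 < N,
  b_trans B q.1 a q1.1 q2.1, (if q.2 is Some u then chk (val u) q.1 a else true),
  q1.2 == child q.2 false & q2.2 == child q.2 true].
exists Q, start, Delta, [set q : Q | b_final B q.1] => t; split.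
  move=> [rho [[r0 rS] acc chkP]].
  have rN u : rho u <= N by apply: ltnW; case: (rS u).
  exists (fun u => (inord (rho u), insub u)); split.
    split=> [|u]; first by rewrite r0.
    rewrite /Delta /= !inordK ?ltnS // -r0; have [_ ->] := rS u.
    have [-> _] := rS [::]; have [-> _] := rS u => /=.
    case: insubP => [v uv vu|nu] /=; first by rewrite -vu chkP ?vu // !eqxx.
    by rewrite !insubN ?eqxx //= -ltnNge ltnW // ltnNge.
  apply/buchi_acceptingE => pi; apply: infinitely_sub (acc pi) => n h.
  by rewrite inE /= inordK // ltnS.
move=> [rho [[r0 rS] /buchi_acceptingE acc]].
have sndE u : (rho u).2 = insub u.
  elim: u => [|b u IH]; first by rewrite r0.
  have /and5P[_ _ _ _ /andP[/eqP h1 /eqP h2]] := rS u.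
  have -> : (rho (b :: u)).2 = child (rho u).2 b by case: b.
  rewrite IH /child; case: insubP => [v uv -> //|nu].
  by rewrite insubN //= -ltnNge ltnW // ltnNge.
exists (fun u => val (rho u).1); split.
- split; last by move=> u; have /and5P[_ h1 h2 _ _] := rS u.
  by rewrite r0 /= inordK //; have /and5P[/ltnW] := rS [::].
- by move=> pi; apply: infinitely_sub (acc pi) => n; rewrite inE.
move=> u ud; have /and5P[_ _ _ + _] := rS u.
by rewrite sndE insubT.
Qed.

Definition trivial_automaton : buchi_automaton S :=
  BuchiAutomaton 1 0 (fun _ _ _ _ => true) (fun _ => true).

Lemma buchi_recognizable_ext (L L' : tree S -> Prop) : (forall t, L t <-> L' t) ->
  buchi_recognizable L -> buchi_recognizable L'.
Proof. by move=> E; have -> : L = L' by apply/funext => t; apply/propext. Qed.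

Lemma buchi_letters d (chk : node -> S -> bool) :
  buchi_recognizable (fun t => forall u, size u <= d -> chk u (t u)).
Proof.
apply: buchi_recognizable_ext (buchi_constrained trivial_automaton d (fun u _ a => chk u a)).
move=> t; split=> [[rho []]//|H]; exists (fun _ => 0); split=> //.
by move=> pi N; exists N.
Qed.

Lemma muller_recognizable_ext (L L' : tree S -> Prop) : (forall t, L t <-> L' t) ->
  muller_recognizable L -> muller_recognizable L'.
Proof. by move=> E; have -> : L = L' by apply/funext => t; apply/propext. Qed.

Lemma buchi_muller (L : tree S -> Prop) : buchi_recognizable L -> muller_recognizable L.
Proof.
move=> [Q [q0 [Delta [Qf LE]]]].
exists Q, q0, Delta, [set P : {set Q} | P :&: Qf != set0] => t; rewrite LE.
suff H (rho : node -> Q) : buchi_accepting Qf rho <->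
    muller_accepting [set P : {set Q} | P :&: Qf != set0] rho.
  by split=> -[rho [h /H]]; exists rho.
rewrite muller_acceptingE; split=> H pi.
  have [q [qf iq]] := H pi; rewrite inE; apply/set0Pn; exists q.
  by rewrite inE qf andbT; apply/infsetP.
have := H pi; rewrite inE => /set0Pn[q]; rewrite inE => /andP[/infsetP iq qf].
by exists q.
Qed.

Lemma buchi_some_branch_often (a : S) : buchi_recognizable (some_branch_often a).
Proof.
(* None: off the guessed branch; Some f: on it, f telling whether the parent carries a. *)
pose Delta (q : option bool) (x : S) (q1 q2 : option bool) :=
  if q is Some _ then ((q1 == Some (x == a)) && (q2 == None)) ||
                      ((q2 == Some (x == a)) && (q1 == None))
  else (q1 == None) && (q2 == None).
exists (option bool), (Some false), Delta, [set q | q != Some false] => t; split.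
  move=> [pi ipi].
  pose rho (u : node) : option bool := if u == node_at pi (size u) then
    Some (if u is _ :: u' then t u' == a else false) else None.
  exists rho; split.
    split=> // u; rewrite /rho /Delta /= !eqseq_cons.
    case: (u =P _) => [_|_]; rewrite ?andbF //= !andbT.
    by case: (pi (size u)); rewrite !eqxx.
  apply/buchi_acceptingE => pi'.
  have [E|/existsNP[k nk]] := pselect (forall n, pi' n = pi n).
    move=> N; have [n [Nn tn]] := ipi N; exists n.+1; split; first exact: leqW.
    rewrite inE /rho (@node_at_ext pi' pi) // size_node_at eqxx /=.
    by rewrite tn eqxx.
  move=> N; exists (maxn N k.+1); split; first exact: leq_maxl.
  rewrite inE /rho size_node_at; case: (node_at pi' _ =P _) => // E; case: nk.
  have : k < maxn N k.+1 by rewrite leq_maxr.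
  elim: (maxn N k.+1) E => // m IH [E1 E2]; rewrite ltnS leq_eqVlt => /orP[/eqP->//|].
  exact: IH.
move=> [rho [[r0 rS] /buchi_acceptingE acc]].
pose on (u : node) := rho u != None.
have /choice[nx nxP] : forall u, exists d, on u -> rho (d :: u) = Some (t u == a).
  move=> u; have := rS u; rewrite /Delta /on; case: (rho u) => [b|]; last by exists true.
  by case/orP=> /andP[/eqP h _]; [exists false|exists true].
pose br := fix br n : node := if n is n'.+1 then nx (br n') :: br n' else [::].
pose pi n := nx (br n).
have brE n : node_at pi n = br n by elim: n => //= n ->.
have onbr n : on (br n) by elim: n => [|n IH]; rewrite /on /= ?r0 // nxP.
exists pi => N; have [[|n] [Nn]] := acc pi N.+1; first by [].
rewrite inE brE /= nxP // => h; exists n; split=> //.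
by rewrite brE; apply/eqP; case: (t (br n) == a) h.
Qed.

(** The sequence codes a run and, for each [k], a depth by which every branch has met a final state
    at level [k] or later. Such depths exist by [branch_bar], and they make acceptance a closed
    condition. *)
Lemma analytic_buchi (L : tree S -> Prop) : buchi_recognizable L -> analytic L.
Proof.
move=> /buchi_code[B LE].
pose C (x : seq bool + nat) t (y : seq bool + nat -> nat) : Prop := match x with
  | inl u => [/\ y (inl [::]) = b_init B, y (inl u) < b_size B &
      b_trans B (y (inl u)) (t u) (y (inl (false :: u))) (y (inl (true :: u)))]
  | inr k => forall pi, exists n, k <= n <= y (inr k) /\ b_final B (y (inl (node_at pi n)))
  end.
apply: (@analytic_count _ (seq bool + nat)%type (fun t y => forall x, C x t y)).
  apply: tree_closed_all => -[u|k]; apply: tree_closed_local => t y.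
    exists [:: u], [:: inl [::]; inl u; inl (false :: u); inl (true :: u)].
    move=> t' y' h1 h2; rewrite /C h1 ?mem_head // !h2 //; by rewrite !inE eqxx ?orbT.
  exists [::], (inr k :: map inl (nodes_upto (y (inr k)))) => t' y' _ h2 H pi.
  have [n [/andP[kn]]] := H pi; rewrite -h2 ?mem_head // => ny fn.
  exists n; rewrite kn ny; split=> //; rewrite h2 // inE map_f ?orbT //.
  by apply: mem_nodes_upto; rewrite size_node_at.
move=> t; rewrite LE; split=> [[rho [[r0 rS] acc]]|[y Cy]].
  have /choice[g gP] : forall k, exists m, forall pi, exists n, k <= n <= m /\
      b_final B (rho (node_at pi n)).
    move=> k; apply: (@branch_bar (fun u => b_final B (rho u))) => pi; exact: acc.
  exists (fun x => match x with inl u => rho u | inr k => g k end) => -[u|k] //=.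
  by have [] := rS u.
exists (fun u => y (inl u)); split.
  split; first by have [] := Cy (inl [::]).
  by move=> u; have [] := Cy (inl u).
by move=> pi N; have [n [/andP[h _] h2]] := Cy (inr N) pi; exists n.
Qed.

End Buchi.

(** * The Choquet game on the Buchi topology *)

Lemma history_rcons (X : Type) (x : nat -> X) (U : nat -> X -> Prop) n :
  [seq (x k, U k) | k <- iota 0 n.+1] = rcons [seq (x k, U k) | k <- iota 0 n] (x n, U n).
Proof. by rewrite -[in LHS]addn1 iotaD map_cat /= cats1. Qed.

Section BuchiGame.
Variable S : finType.

Definition tracked := (buchi_automaton S * (node -> nat))%type.

(* What Player 2 remembers: the last tree played, the automata entered so far, each
   with an accepting run on that tree, and the depth up to which the tree and the
   runs are frozen. *)
Record commitment := Commitment {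
  c_tree : tree S;
  c_runs : seq tracked;
  c_depth : nat }.

Implicit Types (s : commitment) (t : tree S).

Definition no_run : tracked := (trivial_automaton S, fun _ => 0).
Definition c_aut s i := (nth no_run (c_runs s) i).1.
Definition c_run s i := (nth no_run (c_runs s) i).2.

Definition c_valid s : Prop := forall i, i < size (c_runs s) ->
  b_run (c_aut s i) (c_tree s) (c_run s i) /\ b_accepting (c_aut s i) (c_run s i).

Definition c_extendable s i t : Prop := exists rho,
  [/\ b_run (c_aut s i) t rho, b_accepting (c_aut s i) rho &
      forall u, size u <= c_depth s -> rho u = c_run s i u].

Definition c_nbhd s t : Prop := (forall u, size u <= c_depth s -> t u = c_tree s u) /\
  forall i, i < size (c_runs s) -> c_extendable s i t.

Lemma c_nbhd_open s : buchi_open S (c_nbhd s).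
Proof.
move=> t [h1 h2].
exists (size (c_runs s)).+1, (fun i => if i is i'.+1 then c_extendable s i'
  else fun t => forall u, size u <= c_depth s -> t u = c_tree s u); split; [|split].
- case=> [|i] is_.
    apply: buchi_recognizable_ext (buchi_letters (c_depth s) (fun u a => a == c_tree s u)).
    by move=> t'; split=> H u us; [apply/eqP|rewrite H]; auto.
  apply: buchi_recognizable_ext
    (buchi_constrained (c_aut s i) (c_depth s) (fun u q _ => q == c_run s i u)).
  move=> t'; split=> -[rho [r1 r2 r3]]; exists rho; split=> // u us.
    by apply/eqP; exact: r3.
  by rewrite r3.
- by case=> [|i] //; rewrite ltnS => /h2.
by move=> t' H; split=> [|i is_]; [exact: (H 0)|exact: (H i.+1)].
Qed.

Lemma c_nbhd_self s : c_valid s -> c_nbhd s (c_tree s).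
Proof. by move=> v; split=> // i /v[h1 h2]; exists (c_run s i). Qed.

Definition c_step s s' t (U : tree S -> Prop) : Prop :=
  [/\ c_tree s' = t /\ c_valid s', c_depth s < c_depth s',
      size (c_runs s) <= size (c_runs s') /\ (forall i, i < size (c_runs s) ->
        c_aut s' i = c_aut s i /\
        forall u, size u <= c_depth s -> c_run s' i u = c_run s i u),
      forall i, i < size (c_runs s') -> forall pi, exists n,
        c_depth s <= n <= c_depth s' /\ b_final (c_aut s' i) (c_run s' i (node_at pi n)) &
      forall t', c_nbhd s' t' -> U t'].

Lemma c_step_exists s t (U : tree S -> Prop) : buchi_open S U -> U t ->
  (forall i, i < size (c_runs s) -> c_extendable s i t) -> exists s', c_step s s' t U.
Proof.
move=> oU Ut ext; have [k [A [Arec [At AU]]]] := oU t Ut.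
pose m := size (c_runs s).
have /choice[tr trP] : forall i, exists tr : tracked, i < m + k ->
    [/\ b_run tr.1 t tr.2, b_accepting tr.1 tr.2,
     i < m -> tr.1 = c_aut s i /\ forall u, size u <= c_depth s -> tr.2 u = c_run s i u &
     m <= i -> forall t', b_accepts tr.1 t' -> A (i - m) t'].
  move=> i; case: (ltnP i m) => im.
    by have [rho [h1 h2 h3]] := ext i im; exists (c_aut s i, rho).
  case: (ltnP i (m + k)) => imk; last by exists no_run.
  have ik : i - m < k by rewrite ltn_subLR.
  have [B BE] := buchi_code (Arec _ ik); have [rho [h1 h2]] := (BE t).1 (At _ ik).
  by exists (B, rho) => _; split=> // _ t' /BE.
have /choice[bar barP] : forall i, exists b, i < m + k -> forall pi, exists n,
    c_depth s <= n <= b /\ b_final (tr i).1 ((tr i).2 (node_at pi n)).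
  move=> i; case: (ltnP i (m + k)) => imk; last by exists 0.
  have [_ acc _ _] := trP i imk.
  have [b bP] := @branch_bar (fun u => b_final (tr i).1 ((tr i).2 u)) (c_depth s)
    (fun pi => acc pi (c_depth s)).
  by exists b.
pose d := (c_depth s).+1 + \max_(i < m + k) bar i.
pose s' := Commitment t (mkseq tr (m + k)) d.
have sz : size (c_runs s') = m + k by rewrite size_mkseq.
have autE i : i < m + k -> c_aut s' i = (tr i).1 /\ c_run s' i = (tr i).2.
  by move=> ik; rewrite /c_aut /c_run /= nth_mkseq.
exists s'; split.
- split=> // i; rewrite sz => ik; have [-> ->] := autE i ik.
  by have [] := trP i ik.
- by rewrite /= /d ltnS leq_addr.
- rewrite sz; split=> [|i im]; first exact: leq_addr.
  have ik : i < m + k by exact: leq_trans im (leq_addr _ _).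
  by have [-> ->] := autE i ik; have [_ _ h _] := trP i ik; exact: h.
- move=> i; rewrite sz => ik pi; have [-> ->] := autE i ik.
  have [n [/andP[h1 h2] h3]] := barP i ik pi; exists n; split=> //.
  rewrite h1 /= /d (leq_trans h2) // (leq_trans _ (leq_addl _ _)) //.
  exact: (@leq_bigmax _ (fun i : 'I_(m + k) => bar i) (Ordinal ik)).
move=> t' [_ H]; apply: AU => i ik.
have imk : m + i < m + k by rewrite ltn_add2l.
have [_ _ _ h] := trP _ imk.
rewrite -[i](addKn m); apply: h; first exact: leq_addr.
have [|rho [h1 h2 _]] := H (m + i); first by rewrite sz.
by exists rho; have [<- _] := autE _ imk.
Qed.

Lemma leq_depth (s : nat -> commitment) n m :
  (forall n, c_depth (s n) < c_depth (s n.+1)) -> n <= m -> c_depth (s n) <= c_depth (s m).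
Proof.
move=> sd /subnKC <-; elim: (m - n) => [|k IH]; first by rewrite addn0.
by rewrite addnS (leq_trans IH) // ltnW.
Qed.

Lemma c_limit (s : nat -> commitment) (x : nat -> tree S) (U : nat -> tree S -> Prop) :
  (forall n, c_step (s n) (s n.+1) (x n) (U n)) ->
  (forall n, c_nbhd (s n.+1) (x n.+1)) -> exists y, forall n, c_nbhd (s n.+1) y.
Proof.
move=> st nb.
have sd n : c_depth (s n) < c_depth (s n.+1) by have [] := st n.
have sdn n : n <= c_depth (s n) by elim: n => // n IH; exact: leq_ltn_trans IH (sd n).
have sx n : c_tree (s n.+1) = x n by have [[]] := st n.
have stabx n m u : n <= m -> size u <= c_depth (s n.+1) -> x m u = x n u.
  move/subnKC <-; elim: (m - n) => [|k IH] us; first by rewrite addn0.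
  rewrite addnS -IH //; have [h _] := nb (n + k); rewrite h ?sx //.
  by apply: leq_trans us (leq_depth sd _); rewrite ltnS leq_addr.
have szm n m : n <= m -> size (c_runs (s n)) <= size (c_runs (s m)).
  move/subnKC <-; elim: (m - n) => [|k IH]; first by rewrite addn0.
  by rewrite addnS (leq_trans IH) //; have [_ _ []] := st (n + k).
have stabr n m i : n <= m -> i < size (c_runs (s n)) -> c_aut (s m) i = c_aut (s n) i /\
    forall u, size u <= c_depth (s n) -> c_run (s m) i u = c_run (s n) i u.
  move/subnKC <-; elim: (m - n) => [|k IH] is_; first by rewrite addn0.
  have [IH1 IH2] := IH is_; have [_ _ [_ h] _ _] := st (n + k).
  have [|h1 h2] := h i; first by apply: leq_trans is_ (szm _ _ (leq_addr _ _)).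
  rewrite addnS h1 IH1; split=> // u us; rewrite h2 ?IH2 //.
  exact: leq_trans us (leq_depth sd (leq_addr _ _)).
(* After round [size u] the label of [u] is frozen, as the depth grows in every round. *)
pose y u := x (size u) u.
have yE m u : size u <= c_depth (s m.+1) -> y u = x m u.
  move=> us; rewrite /y; case: (leqP (size u) m) => h.
    by apply: esym; apply: stabx => //; apply: leq_trans (sdn _).
  by apply: stabx => //; exact: ltnW.
exists y => n; split=> [u us|i is_]; first by rewrite sx (yE n).
(* Entry [i] is sure to be tracked only from stage [n.+1] on, hence the maximum. *)
pose rho u := c_run (s (maxn n.+1 (size u))) i u.
have rhoE m u : n < m -> size u <= c_depth (s m) -> rho u = c_run (s m) i u.
  move=> nm us; rewrite /rho; set k := maxn _ _.
  have nk : n.+1 <= k by exact: leq_maxl.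
  have uk : size u <= c_depth (s k) by apply: leq_trans (sdn k); exact: leq_maxr.
  have ik : i < size (c_runs (s k)) by exact: leq_trans is_ (szm _ _ nk).
  have im : i < size (c_runs (s m)) by exact: leq_trans is_ (szm _ _ nm).
  case: (leqP k m) => km; first by have [_ ->] := stabr _ _ _ km ik.
  by have [_ ->] := stabr _ _ _ (ltnW km) im.
have autE m : n < m -> c_aut (s m) i = c_aut (s n.+1) i.
  by move=> nm; have [] := stabr _ _ _ nm is_.
have validm m : n < m -> b_run (c_aut (s n.+1) i) (c_tree (s m)) (c_run (s m) i).
  case: m => // m nm; have [[_ v] _ _ _ _] := st m.
  by have [|h _] := v i; [exact: leq_trans is_ (szm _ _ nm)|rewrite -(autE _ nm)].
exists rho; split.
- split=> [|u].
    by rewrite (rhoE n.+1) //; have [] := validm _ (ltnSn n).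
  set m := (n + (size u).+1).+1.
  have um : (size u).+1 <= c_depth (s m).
    by apply: leq_trans (sdn _); rewrite leqW // leq_addl.
  have nm : n < m by rewrite ltnS leq_addr.
  rewrite !(rhoE m) //; try exact: ltnW.
  by have [_ h] := validm _ nm; rewrite (yE (n + (size u).+1)) -?sx; [exact: h|exact: ltnW].
- move=> pi N; set m := (n + N).+1.
  have [_ _ _ h _] := st m; have nm : n < m by rewrite ltnS leq_addr.
  have [|k [/andP[k1 k2] k3]] := h i _ pi.
    by apply: leq_trans is_ (szm _ _ _); rewrite leqW.
  exists k; split.
    by apply: leq_trans (leq_trans (sdn m) k1); rewrite leqW // leq_addl.
  have nm1 : n < m.+1 by exact: leqW.
  by rewrite -(autE m.+1 nm1) (rhoE m.+1 _ nm1) ?size_node_at.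
by move=> u us; rewrite (rhoE n.+1).
Qed.

Lemma buchi_strong_choquet : (exists a : S, True) -> strong_choquet (buchi_open S).
Proof.
move=> [a _]; split; first by exists (fun _ => a).
pose s0 := Commitment (fun _ => a) [::] 0.
have /choice[next nextP] : forall c : commitment * (tree S * (tree S -> Prop)),
    exists s', (exists s', c_step c.1 s' c.2.1 c.2.2) -> c_step c.1 s' c.2.1 c.2.2.
  move=> c; have [[s' h]|h] := pselect (exists s', c_step c.1 s' c.2.1 c.2.2).
    by exists s'.
  by exists s0.
(* The commitment is recomputed from the history, starting from [s0], which tracks no automaton. *)
pose sigma h := c_nbhd (foldl (fun s mv => next (s, mv)) s0 h).
exists sigma.
pose s (x : nat -> tree S) (U : nat -> tree S -> Prop) n :=
  foldl (fun s mv => next (s, mv)) s0 [seq (x k, U k) | k <- iota 0 n].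
have sE x U n : sigma (history x U n) = c_nbhd (s x U n.+1) by [].
have step x U n : legal_upto (buchi_open S) sigma x U n ->
    c_step (s x U n) (s x U n.+1) (x n) (U n).
  move=> leg; have [oU [Ux sub]] := leg n (leqnn n).
  rewrite /s history_rcons foldl_rcons; apply: (nextP (_, _)) => /=.
  apply: c_step_exists => //; case: n sub Ux {oU leg} => [//|n] sub Ux.
  by have [] := sub isT _ Ux.
split=> [x U n leg V|x U leg].
  have [[sx v] _ _ _ h] := step x U n leg.
  split; first exact: c_nbhd_open.
  by split=> //; rewrite -sx; exact: c_nbhd_self.
have [|y yP] := @c_limit (s x U) x U (fun n => step x U n (leg n)); last by exists y.
move=> n; have [_ [Ux sub]] := leg n.+1 n.+1 (leqnn _); exact: sub.
Qed.

End BuchiGame.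

(** * Countable bases and strong Choquet topologies *)

(** Automata with states ['I_n.+1] are countably many. Any other is carried over by pulling
    transitions and acceptance back along a surjection [g] with section [f]; the surplus index goes
    to [q0]. *)
Lemma muller_enumeration (S : finType) : exists e : nat -> tree S -> Prop,
  (forall n, muller_recognizable (e n)) /\
  forall L, muller_recognizable L -> exists n, e n = L.
Proof.
pose T n : finType := ('I_n.+1 * {ffun 'I_n.+1 * S * 'I_n.+1 * 'I_n.+1 -> bool} *
  {set {set 'I_n.+1}})%type.
pose K : countType := {n : nat & T n}.
pose lang n (c : T n) (t : tree S) := exists rho,
  is_run c.1.1 (fun q a q1 q2 => c.1.2 (q, a, q1, q2)) t rho /\ muller_accepting c.2 rho.
have lang_rec n (c : T n) : muller_recognizable (lang n c).
  by exists 'I_n.+1, c.1.1, (fun q a q1 q2 => c.1.2 (q, a, q1, q2)), c.2.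
pose dflt : K := existT (fun n => T n) 0 (ord0, [ffun => true], setT).
pose e i := let c : K := odflt dflt (unpickle i) in lang (tag c) (tagged c).
exists e; split=> [i|L [Q [q0 [Delta [F LE]]]]]; first exact: lang_rec.
pose n := #|Q|; pose g (p : 'I_n.+1) : Q := nth q0 (enum Q) p.
pose f (q : Q) : 'I_n.+1 := inord (index q (enum Q)).
have gf : cancel f g.
  by move=> q; rewrite /g /f inordK ?nth_index ?mem_enum // ltnS /n cardE index_size.
pose c : T n := (f q0, [ffun x => Delta (g x.1.1.1) x.1.1.2 (g x.1.2) (g x.2)],
  [set P : {set 'I_n.+1} | g @: P \in F]).
exists (pickle (existT (fun n => T n) n c : K)); apply: funext => t; apply: propext.
rewrite /e pickleK /= LE; split=> -[rho [[r0 rS] /muller_acceptingE acc]].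
  exists (g \o rho); split.
    split=> [|u]; first by rewrite /= r0 gf.
    by have := rS u; rewrite ffunE.
  by apply/muller_acceptingE => pi; have := acc pi; rewrite inE -infset_map.
exists (f \o rho); split.
  split=> [|u]; first by rewrite /= r0.
  by rewrite /= ffunE /= !gf.
apply/muller_acceptingE => pi; rewrite inE -infset_map; have := acc pi.
by congr (infset _ \in F); apply: funext => k /=; rewrite gf.
Qed.

Lemma muller_letter (S : finType) (u : node) (a : S) : muller_recognizable (fun t => t u = a).
Proof.
apply: muller_recognizable_ext (buchi_muller
  (buchi_letters (size u) (fun v x => (v == u) ==> (x == a)))) => t; split=> [H|<- v _].
  by apply/eqP; have := H u (leqnn _); rewrite eqxx.
by apply/implyP => /eqP->.
Qed.

Section CountableBase.
Variables (X : Type) (B : (X -> Prop) -> Prop) (e : nat -> X -> Prop).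
Hypotheses (eB : forall n, B (e n)) (Be : forall L, B L -> exists n, e n = L).

Definition basic (c : seq nat) (x : X) : Prop := forall i, i \in c -> e i x.

Lemma basic_open c : generated_open B (basic c).
Proof.
move=> x xc; exists (size c), (fun i => e (nth 0 c i)); split=> //; split.
  by move=> i ic; apply: xc; rewrite mem_nth.
by move=> y H i ic; rewrite -(nth_index 0 ic); apply: H; rewrite index_mem.
Qed.

Lemma basic_nbhd U x : generated_open B U -> U x ->
  exists c, basic c x /\ forall y, basic c y -> U y.
Proof.
move=> oU Ux; have [k [A [AB [Ax AU]]]] := oU x Ux.
have /choice[n nP] : forall i, exists n, i < k -> e n = A i.
  move=> i; case: (ltnP i k) => [ik|_]; last by exists 0.
  by have [n nE] := Be (AB i ik); exists n.
exists [seq n i | i <- iota 0 k]; split.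
  by move=> _ /mapP[i + ->]; rewrite mem_iota /= add0n => ik; rewrite nP //; exact: Ax.
move=> y H; apply: AU => i ik; rewrite -nP //; apply: H.
by apply: map_f; rewrite mem_iota.
Qed.

End CountableBase.

(** * Open sets of second countable strong Choquet topologies as projections *)

Section StrongChoquet.
Variables (S : finType) (B : (tree S -> Prop) -> Prop) (e : nat -> tree S -> Prop).
Hypotheses (eB : forall n, B (e n)) (Be : forall L, B L -> exists n, e n = L).
Hypothesis Bletter : forall u (a : S), B (fun t => t u = a).

Let open := generated_open B.

Lemma open_cylinder t n : open (fun t' => forall u, size u < n -> t' u = t u).
Proof.
move=> x xt; pose s := nodes_upto n.
exists (size s), (fun i t' => t' (nth [::] s i) = x (nth [::] s i)).
split=> //; split=> // y H u un; rewrite -xt //.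
have us : u \in s by apply: mem_nodes_upto; exact: ltnW.
by have := H (index u s); rewrite index_mem nth_index //; apply.
Qed.

Lemma open_and U V : open U -> open V -> open (fun x => U x /\ V x).
Proof.
move=> oU oV x [/oU[k [A [A1 [A2 A3]]]] /oV[k' [A' [A1' [A2' A3']]]]].
exists (k + k'), (fun i => if i < k then A i else A' (i - k)); split; [|split].
- move=> i ik; case: ltnP => h; first exact: A1.
  by apply: A1'; rewrite ltn_subLR.
- move=> i ik; case: ltnP => h; first exact: A2.
  by apply: A2'; rewrite ltn_subLR.
move=> y H; split; [apply: A3 => i ik|apply: A3' => i ik].
  by have := H i; rewrite ik; apply; exact: leq_trans ik (leq_addr _ _).
by have := H (k + i); rewrite ltn_add2l (ltnNge (k + i)) leq_addr addKn /=; apply.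
Qed.

Variables (sigma : strategy2 (tree S)) (win : winning2 open sigma).
Variable t0 : tree S.

Let move := (seq nat * seq nat)%type.

(* Player 1 restricted to countably many moves: (d, c) stands for the open set
   [basic e d] together with some point making Player 2 answer a superset of
   [basic e c]. *)
Definition answers (h : seq (tree S * (tree S -> Prop))) (m : move) (x : tree S) : Prop :=
  basic e m.1 x /\ forall t, basic e m.2 t -> sigma (rcons h (x, basic e m.1)) t.

Lemma answering_point : exists pt : seq (tree S * (tree S -> Prop)) -> move -> tree S,
  forall h m, (exists x, answers h m x) -> answers h m (pt h m).
Proof.
have /choice[pt ptP] : forall hm, exists x,
    (exists x, answers hm.1 hm.2 x) -> answers hm.1 hm.2 x.
  move=> hm; have [[x xP]|nx] := pselect (exists x, answers hm.1 hm.2 x).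
    by exists x.
  by exists t0.
by exists (fun h m => pt (h, m)) => h m; exact: (ptP (h, m)).
Qed.

(** The sequence codes the moves of Player 1 in a play that starts inside [P] and shrinks to [t];
    each [ok n] reads finitely many coordinates. A point surviving the play agrees with [t] at every
    node, so [t] is in [P]. *)
Lemma open_analytic P : open P -> analytic P.
Proof.
have [pt ptP] := answering_point; move=> oP.
pose mv (y : nat -> nat) n : move := odflt ([::], [::]) (unpickle (y n)).
pose H y := fix H n := if n is n'.+1 then
  rcons (H n') (pt (H n') (mv y n'), basic e (mv y n').1) else [::].
pose prev y n := if n is 0 then P else sigma (H y n).
pose ok n (t : tree S) y := [/\ exists x, answers (H y n) (mv y n) x,
  forall t', basic e (mv y n).1 t' -> prev y n t' &
  forall t', basic e (mv y n).1 t' -> forall u, size u < n -> t' u = t u].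
have Hext n y y' : (forall i, i < n -> y i = y' i) -> H y n = H y' n.
  elim: n => //= n IH E; rewrite IH; last by move=> i ni; apply: E; exact: ltnW.
  by rewrite /mv E.
exists (fun t y => forall n, ok n t y); split.
  apply: tree_closed_all => n; apply: tree_closed_local => t y.
  exists (nodes_upto n), (iota 0 n.+1) => t' y' Et Ey.
  have HE : H y n = H y' n by apply: Hext => i ni; apply: Ey; rewrite mem_iota /= ltnS ltnW.
  have mvE : mv y n = mv y' n by rewrite /mv Ey // mem_iota /= ltnS leqnn.
  have pE : prev y n = prev y' n by rewrite /prev; case: n HE {Et Ey mvE} => //= n ->.
  rewrite /ok -HE -mvE -pE => -[h1 h2 h3]; split=> // t1 /h3 E u un.
  by rewrite E // Et //; apply: mem_nodes_upto; exact: ltnW.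
move=> t; split=> [Pt|[y yok]]; last first.
  pose x n := pt (H y n) (mv y n); pose U n := basic e (mv y n).1.
  have histE n : history x U n = H y n.+1.
    by rewrite /history; elim: n => // n IH; rewrite history_rcons IH.
  have leg n : legal_upto open sigma x U n.
    move=> k _; have [/ptP[h1 _] h2 _] := yok k; split; first exact: basic_open.
    by split=> // k0 t' Ut'; case: k k0 h1 h2 Ut' => // k _ _ h2 Ut'; rewrite histE; exact: h2.
  have [w [sw wP]] : exists w, (forall n, sigma (history x U n) w) /\ True.
    by have [w wP] := win.2 x U leg; exists w.
  have Uw n : U n w by have [_ [_ sub]] := win.1 x U n (leg n); exact: sub.
  have -> : t = w.
    apply: funext => u; have [_ _ h] := yok (size u).+1.
    by rewrite (h w (Uw _)).
  by have [_ h _] := yok 0; exact: h (Uw 0).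
(* Both basic sets are also required to contain [t], so that Player 2's answer contains [t] and the
   play can go on around it. *)
pose good (hn : seq (tree S * (tree S -> Prop)) * nat) (m : move) :=
  [/\ basic e m.1 t /\ basic e m.2 t, exists x, answers hn.1 m x,
  forall t', basic e m.1 t' -> (if hn.2 is 0 then P else sigma hn.1) t' &
  forall t', basic e m.1 t' -> forall u, size u < hn.2 -> t' u = t u].
have /choice[mvf mvfP] : forall hn, exists m, (exists m, good hn m) -> good hn m.
  move=> hn; have [[m gm]|nm] := pselect (exists m, good hn m); first by exists m.
  by exists ([::], [::]).
pose hh := fix hh n := if n is n'.+1 then
  rcons (hh n') (pt (hh n') (mvf (hh n', n')), basic e (mvf (hh n', n')).1) else [::].
pose y n := pickle (mvf (hh n, n)).
have mvE n : mv y n = mvf (hh n, n) by rewrite /mv /y pickleK.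
have HE n : H y n = hh n by elim: n => //= n ->; rewrite mvE.
suff gd n : good (hh n, n) (mvf (hh n, n)).
  exists y => n; have [_ h1 h2 h3] := gd n; rewrite /ok HE mvE; split=> // t' /h2.
  by rewrite /prev; case: n h1 h2 h3 => // n; rewrite HE.
elim/ltn_ind: n => n IH; apply: mvfP.
pose x k := pt (hh k) (mvf (hh k, k)); pose U k := basic e (mvf (hh k, k)).1.
have histE k : history x U k = hh k.+1.
  by rewrite /history; elim: k => // k IHk; rewrite history_rcons IHk.
have leg k : k < n -> legal_upto open sigma x U k.
  move=> kn j jk; have [_ /ptP[h1 _] h2 _] := IH j (leq_ltn_trans jk kn).
  split; first exact: basic_open.
  by split=> // j0 t' Ut'; case: j j0 h2 Ut' {h1 jk} => // j _ h2 Ut'; rewrite histE; exact: h2.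
pose V := if n is 0 then P else sigma (hh n).
have [oV Vt] : open V /\ V t.
  rewrite /V; case: n IH leg @V => // n IH leg _.
  have [[_ ct] /ptP[_ h] _ _] := IH n (ltnSn n); split; last exact: h.
  by have [] := win.1 x U n (leg n (ltnSn n)); rewrite histE.
have [d [dt dV]] : exists d, basic e d t /\ forall t', basic e d t' ->
    V t' /\ forall u, size u < n -> t' u = t u.
  have [|d [h1 h2]] := @basic_nbhd _ B e Be _ t (@open_and _ _ oV (@open_cylinder t n)).
    by split.
  by exists d.
(* Player 1 is made to play [t] itself in round [n]. A basic set around [t] inside the answer
   completes the move, and [t] shows that the move has an answering point. *)
pose x' k := if k < n then x k else t; pose U' k := if k < n then U k else basic e d.
have hist' k : k < n -> history x' U' k = hh k.+1.
  move=> kn; rewrite -histE; apply/eq_in_map => j; rewrite mem_iota /= add0n ltnS => jk.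
  by rewrite /x' /U' (leq_ltn_trans jk kn).
have histn : history x' U' n = rcons (hh n) (t, basic e d).
  have hk k : k <= n -> [seq (x' j, U' j) | j <- iota 0 k] = hh k.
    by case: k => // k; exact: hist'.
  by rewrite /history history_rcons hk // /x' /U' ltnn.
have leg' : legal_upto open sigma x' U' n.
  move=> k; rewrite leq_eqVlt => /orP[/eqP->|kn].
    rewrite /x' /U' ltnn -/x' -/U'; split; first exact: basic_open.
    split=> // n0 t' /dV[+ _]; rewrite hist' ?prednK //.
    by rewrite /V; case: (n) n0.
  have := leg k kn k (leqnn k); rewrite {1 2}/x' {1 2 3}/U' kn => -[h1 [h2 h3]].
  split=> //; split=> // k0; rewrite hist' ?prednK ?(ltnW kn) //.
  by have := h3 k0; rewrite histE prednK.
have [osig [sigt _]] := win.1 x' U' n leg'.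
move: osig sigt; rewrite histn {1}/x' ltnn => osig sigt.
have [c [ct csub]] := basic_nbhd Be osig sigt.
exists (d, c); split=> //=; first by exists t.
  by move=> t' /dV[].
by move=> t' /dV[].
Qed.

End StrongChoquet.

(** * Failure of regularity for the Buchi topology *)

Section BuchiNotRegular.
Variables (S : finType) (a b : S) (ab : a != b).

Lemma buchi_enumeration : exists e : nat -> tree S -> Prop,
  (forall n, buchi_recognizable (e n)) /\
  forall L, buchi_recognizable L -> exists n, e n = L.
Proof.
have [e [_ eP]] := muller_enumeration S.
have topB : buchi_recognizable (fun _ : tree S => True).
  by apply: buchi_recognizable_ext (buchi_letters 0 (fun _ (_ : S) => true)).
exists (fun n => if pselect (buchi_recognizable (e n)) then e n else fun _ => True).
split=> [n|L LB]; first by case: pselect.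
have [n nE] := eP _ (buchi_muller LB); exists n; rewrite nE; by case: pselect.
Qed.

Lemma analytic_true : analytic (fun _ : tree S => True).
Proof. by exists (fun _ _ => True); split=> // t; split=> // _; exists (fun i => i). Qed.

Lemma analytic_false : analytic (fun _ : tree S => False).
Proof.
exists (fun _ _ => False); split=> [t y H|t]; last by split=> // -[].
by have [t' [y' []]] := H [::] [::].
Qed.

Lemma analytic_buchi_open (U : tree S -> Prop) : buchi_open S U -> analytic U.
Proof.
have [e [eB eP]] := buchi_enumeration; move=> oU.
have basicA c : analytic (basic e c).
  apply: (analytic_bigcap (P := fun i t => i \in c -> e i t)) => i.
  case: (i \in c).
    have -> : (fun t => true -> e i t) = e i; last exact: analytic_buchi.
    by apply: funext => t; apply: propext; split=> [/(_ isT)|].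
  have -> : (fun t => false -> e i t) = fun _ => True; last exact: analytic_true.
  by apply: funext => t; apply: propext; split.
pose W n : tree S -> Prop := if unpickle n is Some c then
  if pselect (forall t', basic e c t' -> U t') then basic e c else fun _ => False
  else fun _ => False.
have -> : U = fun t => exists n, W n t.
  apply: funext => t; apply: propext; rewrite /W; split=> [Ut|[n]].
    have [c [ct cU]] := basic_nbhd eP oU Ut; exists (pickle c); rewrite pickleK.
    by case: pselect.
  by case: (unpickle n) => // c; case: pselect => // H; exact: H.
apply: analytic_bigcup => n; rewrite /W.
case: (unpickle n) => [c|]; last exact: analytic_false.
by case: pselect => H; [exact: basicA|exact: analytic_false].
Qed.

Lemma buchi_not_regular : ~ regular (buchi_open S).
Proof.
move=> reg; apply: (not_analytic_no_branch_often ab).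
have [e [eB eP]] := buchi_enumeration.
pose L := some_branch_often a.
have oL : buchi_open S L.
  move=> t Lt; exists 1, (fun _ => L); split; first by move=> _ _; exact: buchi_some_branch_often.
  by split=> // t' H; exact: (H 0).
have clL : Defs.closed (buchi_open S) (fun t => ~ L t).
  by have := oL; rewrite /Defs.closed; congr buchi_open; apply: funext => t;
    apply: propext; split=> [Lt|/contrapT].
(* For each basic set missed by some open superset of the complement of [L], one such superset is
   fixed; for the others any open superset will do. *)
have /choice[V VP] : forall n, exists V, [/\ buchi_open S V, forall t, ~ L t -> V t &
    forall c, unpickle n = Some c ->
      (exists W, [/\ buchi_open S W, forall t, ~ L t -> W t & forall t, ~ (basic e c t /\ W t)]) ->
      forall t, ~ (basic e c t /\ V t)].
  have oT : buchi_open S (fun _ => True).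
    by move=> t _; exists 0, (fun _ _ => True).
  move=> n; case: (unpickle n) => [c|]; last by exists (fun _ => True).
  have [[W [W1 W2 W3]]|nW] := pselect (exists W, [/\ buchi_open S W,
      forall t, ~ L t -> W t & forall t, ~ (basic e c t /\ W t)]).
    by exists W; split=> // _ [<-].
  by exists (fun _ => True); split=> // _ [<-].
(* Regularity gives every [t] in [L] a basic neighbourhood of the first kind, so the [V n] intersect
   exactly in the complement of [L]. *)
have <- : (fun t => forall n, V n t) = (fun t => ~ L t).
  apply: funext => t; apply: propext; split=> [Vt Lt|nLt n]; last first.
    by have [_ h _] := VP n; exact: h.
  have [U [W [oU [oW [Ut [WL UW]]]]]] := reg t _ clL (fun h => h Lt).
  have [c [ct cU]] := basic_nbhd eP oU Ut.
  have [_ _ h] := VP (pickle c); apply: (h c (pickleK _) _ t); last by split.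
  by exists W; split=> // t' [/cU h1 h2]; exact: (UW t').
by apply: analytic_bigcap => n; apply: analytic_buchi_open; have [] := VP n.
Qed.

End BuchiNotRegular.

(** * Metrizability *)

Section Topologies.
Variables (X : Type) (open : (X -> Prop) -> Prop).

Lemma zero_dimensional_regular : zero_dimensional open -> regular open.
Proof.
move=> zd x C clC nCx; have [V [[oV cV] [Vx VC]]] := zd _ x clC nCx.
exists V, (fun y => ~ V y); do 4?split=> //; last by move=> y [].
by move=> y Cy Vy; exact: VC Vy Cy.
Qed.

Lemma metrizable_regular : metrizable open -> regular open.
Proof.
move=> [d [[d0 [dE [dC dT]]] dO]] x C clC nCx.
have [eps [e0 He]] := proj1 (dO _) clC x nCx.
exists (fun y => d x y < eps / 2)%R, (fun y => eps / 2 < d x y)%R.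
split; [|split; [|split; [|split]]].
- apply/dO => y xy; exists (eps / 2 - d x y)%R; split=> [|z yz]; first by lra.
  by have := dT x y z; lra.
- apply/dO => y xy; exists (d x y - eps / 2)%R; split=> [|z yz]; first by lra.
  by have := dT x z y; rewrite (dC z y); lra.
- by have -> : d x x = 0%R by [apply/dE]; lra.
- move=> y Cy; apply: Rnot_le_lt => h; apply: He Cy; lra.
by move=> y; lra.
Qed.

Lemma polish_metrizable : polish open -> metrizable open.
Proof. by move=> [_ [d [cd _]]]; exists d. Qed.

(** Player 2 answers round [n] with a ball of radius at most [(/ 2) ^ n] whose closed ball lies in
    the set played. The points form a Cauchy sequence, and its limit lies in all the closed
    balls. *)
Lemma polish_strong_choquet : polish open -> strong_choquet open.
Proof.
move=> [[s sP] [d [[[d0 [dE [dC dT]]] dO] dcomp]]].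
have dxx x : d x x = 0%R by apply/dE.
split; first by exists (s 0).
have /choice[rad radP] : forall c : X * (X -> Prop) * nat, exists r, (0 < r)%R /\
    (r <= (/ 2) ^ c.2)%R /\ (open c.1.2 -> c.1.2 c.1.1 ->
    forall y, (d c.1.1 y <= r)%R -> c.1.2 y).
  move=> [[x U] n] /=; have p0 : (0 < (/ 2) ^ n)%R by apply: pow_lt; lra.
  have [[oU Ux]|nU] := pselect (open U /\ U x); last first.
    exists ((/ 2) ^ n)%R; split=> //; split; first exact: Rle_refl.
    by move=> oU Ux; case: nU.
  have [eps [e0 He]] := proj1 (dO _) oU x Ux.
  exists (Rmin ((/ 2) ^ n) (eps / 2))%R; split; first by apply: Rmin_glb_lt => //; lra.
  split=> [|_ _ y]; first exact: Rmin_l.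
  have := Rmin_r ((/ 2) ^ n)%R (eps / 2)%R => h1 h2; apply: He; lra.
pose sigma (h : seq (X * (X -> Prop))) : X -> Prop :=
  if h is m :: h' then let c := last m h' in fun y => (d c.1 y < rad (c, size h'))%R
  else fun _ => True.
exists sigma.
have sE x U n : sigma (history x U n) = fun y => (d (x n) y < rad (x n, U n, n))%R.
  rewrite /history; have := history_rcons x U n.
  set s1 := [seq _ | _ <- iota 0 n.+1] => E.
  have sz : size s1 = n.+1 by rewrite size_map size_iota.
  have ls : last (x 0, U 0) s1 = (x n, U n) by rewrite E last_rcons.
  by case: s1 {E} sz ls => //= m h' [->] ->.
split=> [x U n leg|x U leg].
  have [oU [Ux _]] := leg n (leqnn n); rewrite sE /=.
  have [r0 [r1 r2]] := radP (x n, U n, n); split; [|split].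
  - apply/dO => y xy; exists (rad (x n, U n, n) - d (x n) y)%R; split=> [|z yz]; first by lra.
    by have := dT (x n) y z; lra.
  - by rewrite dxx.
  - by move=> y h; apply: r2 => //=; lra.
have Ux n : U n (x n) by have [_ []] := leg n n (leqnn n).
have oU n : open (U n) by have [] := leg n n (leqnn n).
have sub n y : U n.+1 y -> (d (x n) y < rad (x n, U n, n))%R.
  by have [_ [_ h]] := leg n.+1 n.+1 (leqnn _) => Uy; have := h isT y Uy; rewrite sE.
have UU n m y : n <= m -> U m y -> U n y.
  move/subnKC <-; elim: (m - n) => [|k IH]; first by rewrite addn0.
  rewrite addnS => /sub h; apply: IH; have [_ [_ r2]] := radP (x (n + k), U (n + k), n + k).
  by apply: r2 => //=; lra.
have near n m : n < m -> (d (x n) (x m) < rad (x n, U n, n))%R.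
  by move=> nm; apply: sub; apply: UU (Ux m).
have small eps : (0 < eps)%R -> exists N, forall n, N <= n -> (rad (x n, U n, n) < eps)%R.
  move=> e0; have [N HN] := pow_lt_1_zero (/ 2) (ltac:(rewrite Rabs_pos_eq; lra)) eps e0.
  exists N => n /leP Nn; have [_ [h _]] := radP (x n, U n, n); move: h => /= h.
  have := HN n Nn; rewrite Rabs_pos_eq; last by apply: pow_le; lra.
  lra.
have [|y yP] := dcomp x.
  move=> eps e0; have [N HN] := small (eps / 2)%R (ltac:(lra)).
  exists N.+1 => m n Nm Nn; have := near N m Nm; have := near N n Nn.
  have := HN N (leqnn N); have := dT (x m) (x N) (x n); rewrite (dC (x m) (x N)); lra.
have Uy n : U n y.
  have [_ [_ r2]] := radP (x n, U n, n); apply: r2 => //=; apply: Rnot_lt_le => h.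
  have [N HN] := yP (d (x n) y - rad (x n, U n, n))%R (ltac:(lra)).
  have := HN (maxn N n.+1) (leq_maxl _ _).
  have := near n (maxn N n.+1) (leq_maxr _ _).
  have := dT (x n) (x (maxn N n.+1)) y; lra.
by exists y => n; rewrite sE; apply: sub.
Qed.

End Topologies.

Section Separation.
Variables (X : Type) (B : (X -> Prop) -> Prop) (e : nat -> X -> Prop).
Hypotheses (eB : forall n, B (e n)) (Be : forall L, B L -> exists n, e n = L).
Hypothesis Bcompl : forall L, B L -> B (fun x => ~ L x).

Lemma generated_open_base L : B L -> generated_open B L.
Proof. by move=> BL x Lx; exists 1, (fun _ => L); do 2!split=> //; move=> y /(_ 0 isT). Qed.

(** A point outside a finite intersection of generators lies in the complement of one of them, again
    a generator. *)
Lemma complemented_zero_dimensional : zero_dimensional (generated_open B).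
Proof.
move=> U x oU Ux; have [k [A [AB [Ax AU]]]] := oU x Ux.
exists (fun y => forall i, i < k -> A i y); split; [split|by split].
  by move=> y Ay; exists k, A.
move=> y /existsNP[i /not_implyP[ik nAy]].
have [k' [A' [h1 [h2 h3]]]] := generated_open_base (Bcompl (AB i ik)) nAy.
by exists k', A'; do 2!split=> //; move=> z /h3 nAz H; apply: nAz; exact: H.
Qed.

Hypothesis separated : forall x y, x <> y -> exists2 L, B L & L x /\ ~ L y.

Definition agree_at (n : nat) (x y : X) : Prop := e n x <-> e n y.

(** The distance is [(/ 2) ^ n] for the least [n] such that [e n] separates the points, an
    ultrametric. *)
Lemma complemented_metrizable : metrizable (generated_open B).
Proof.
have /choice[m mP] : forall c : X * X, exists m, c.1 <> c.2 ->
    ~ agree_at m c.1 c.2 /\ forall n, ~ agree_at n c.1 c.2 -> m <= n.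
  move=> [x y] /=; have [->|xy] := pselect (x = y); first by exists 0.
  have ex : exists n, `[< ~ agree_at n x y >].
    have [L /Be[n <-] [Lx nLy]] := separated xy; exists n; apply/asboolP; rewrite /agree_at; tauto.
  case: (ex_minnP ex) => k /asboolP kP kmin; exists k => _; split=> // n nP.
  by apply: kmin; apply/asboolP.
pose d x y : R := if pselect (x = y) then 0%R else ((/ 2) ^ m (x, y))%R.
have pow0 n : (0 < (/ 2) ^ n)%R by apply: pow_lt; lra.
have pow_anti n k : n <= k -> ((/ 2) ^ k <= (/ 2) ^ n)%R.
  move/subnKC <-; elim: (k - n) => [|j IH]; first by rewrite addn0; apply: Rle_refl.
  by rewrite addnS /=; have := pow0 (n + j); lra.
have dP k x y : (d x y < (/ 2) ^ k)%R <-> forall n, n <= k -> agree_at n x y.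
  rewrite /d; case: pselect => [E|xy] /=; first by rewrite -E; split=> // _; exact: pow0.
  have [/= h1 h2] := mP (x, y) xy; split=> [lt n nk|H].
    apply: contrapT => /h2 h; have := pow_anti _ _ (leq_trans h nk); lra.
  have km : k < m (x, y) by rewrite ltnNge; apply/negP => /H.
  have := pow_anti _ _ km; have := pow0 k; rewrite /=; lra.
have dd n x y : ~ agree_at n x y -> ((/ 2) ^ n <= d x y)%R.
  by move=> h; apply: Rnot_lt_le => /dP/(_ n (leqnn n)).
have d0 x y : (0 <= d x y)%R.
  by rewrite /d; case: pselect => xy /=; [exact: Rle_refl|apply: Rlt_le].
have agC n x y : agree_at n x y <-> agree_at n y x by rewrite /agree_at; tauto.
exists d; split; first split=> //.
  split; [|split].
  - move=> x y; rewrite /d; case: pselect => [//|xy] /=; split=> // h.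
    by have := pow0 (m (x, y)); lra.
  - have le x y : (d x y <= d y x)%R.
      rewrite {1}/d; case: pselect => [?|xy] /=; first exact: d0.
      have [/= h _] := mP (x, y) xy; apply: dd; by rewrite agC.
    by move=> x y; apply: Rle_antisym.
  - move=> x y z; rewrite {1}/d; case: pselect => [?|xz] /=.
      by have := d0 x y; have := d0 y z; lra.
    have [/= h _] := mP (x, z) xz; have := d0 x y; have := d0 y z.
    have [hxy|/dd] := pselect (agree_at (m (x, z)) x y); last by lra.
    have [hyz|/dd] := pselect (agree_at (m (x, z)) y z); last by lra.
    by case: h; move: hxy hyz; rewrite /agree_at; tauto.
move=> U; split=> [oU x Ux|H x Ux].
  have [c [xc cU]] := basic_nbhd Be oU Ux.
  exists ((/ 2) ^ (\max_(i <- c) i))%R; split; first exact: pow0.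
  move=> y /dP H; apply: cU => i ic.
  have /H[h _] : i <= \max_(i <- c) i by exact: (@leq_bigmax_seq _ c xpredT (fun i => i)).
  exact: h (xc _ ic).
have [eps [e0 He]] := H x Ux.
have [k kP] : exists k, ((/ 2) ^ k < eps)%R.
  have [N HN] := pow_lt_1_zero (/ 2) (ltac:(rewrite Rabs_pos_eq; lra)) eps e0.
  by exists N; have := HN N (le_n N); rewrite Rabs_pos_eq //; apply: Rlt_le.
(* The ball of radius [(/ 2) ^ k] is cut out by [k.+1] conditions, each of them [e i] or its
   complement. *)
exists k.+1, (fun i y => e i y <-> e i x); split; [|split] => [i _|//|y yH].
  have [ex|nex] := pselect (e i x).
    by have -> : (fun y => e i y <-> e i x) = e i
      by [apply: funext => y; apply: propext; tauto]; exact: eB.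
  have -> : (fun y => e i y <-> e i x) = (fun y => ~ e i y).
    by apply: funext => y; apply: propext; tauto.
  exact: Bcompl.
apply: He; apply: Rlt_trans kP; apply/dP => n nk; apply/agC; exact: yH.
Qed.

End Separation.

Lemma muller_not_strong_choquet (S : finType) (a b : S) : a != b ->
  ~ strong_choquet (muller_open S).
Proof.
move=> ab [[t _] [sigma win]].
have [e [eB eP]] := muller_enumeration S.
apply: (not_analytic_no_branch_often ab).
apply: (open_analytic eB eP (@muller_letter S) win t).
apply: generated_open_base; apply: muller_complement; apply: buchi_muller.
exact: buchi_some_branch_often.
Qed.

Theorem theorem4p5 (S : finType) (hS : 1 < #|S|) :
  (* (1) Büchi topology *)
  (strong_choquet (buchi_open S) /\
   ~ regular (buchi_open S) /\
   ~ zero_dimensional (buchi_open S) /\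
   ~ metrizable (buchi_open S)) /\
  (* (2) Muller topology *)
  (zero_dimensional (muller_open S) /\
   regular (muller_open S) /\
   metrizable (muller_open S) /\
   ~ strong_choquet (muller_open S)) /\
  (* neither is Polish *)
  (~ polish (buchi_open S) /\ ~ polish (muller_open S)).
Proof.
have [a [b [_ _ ab]]] := card_gt1P hS.
have bnr : ~ regular (buchi_open S) := buchi_not_regular ab.
have bnm : ~ metrizable (buchi_open S) by move=> /metrizable_regular.
have mnc : ~ strong_choquet (muller_open S) := muller_not_strong_choquet ab.
have [e [eB eP]] := muller_enumeration S.
have mzd : zero_dimensional (muller_open S).
  by apply: complemented_zero_dimensional => L; exact: muller_complement.
split; [|split]; [split; [|split; [|split]]|split; [|split; [|split]]|split] => //.
- by apply: buchi_strong_choquet; exists a.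
- by move=> /zero_dimensional_regular.
- exact: zero_dimensional_regular.
- apply: (complemented_metrizable eB eP) => [L|x y xy]; first exact: muller_complement.
  have [u /eqP xu] : exists u, x u <> y u.
    by apply: contrapT => /forallNP H; apply: xy; apply: funext => u; apply: contrapT => /H.
  exists (fun t => t u = x u); first exact: muller_letter.
  by split=> // E; rewrite E eqxx in xu.
- by move=> /polish_metrizable.
by move=> /polish_strong_choquet.
Qed.
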